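(* Let $k$ be a field and let $A$ be an $\mathbb{A}^2$-form over $k$ with respect to a field extension $L|_k$. Suppose that (i) $A$ is a unique factorization domain; (ii) $A$ has a $k$-rational point (equivalently, $A$ has a retraction to $k$, i.e. there is a $k$-algebra homomorphism $A\to k$); and (iii) $A$ is non-rigid. Then $A=k^{[2]}$.
   Context: All rings are commutative and unital. For an algebra $C$ over a ring $R$, write $C=R^{[n]}$ if $C=R[t_1,\dots,t_n]$ for some $t_1,\dots,t_n\in C$ algebraically independent over $R$ (i.e. $C$ is isomorphic as an $R$-algebra to a polynomial ring in $n$ indeterminates over $R$). For a field extension $L|_k$, a $k$-algebra $A$ is an $\mathbb{A}^n$-form over $k$ with respect to $L|_k$ if $A\otimes_k L = L^{[n]}$ (as $L$-algebras). An exponential map (equivalently, a $\mathbb{G}_a$-action) on a $k$-algebra $A$ is a $k$-algebra homomorphism $\phi: A\to A^{[1]}$ such that, writing $\phi_U: A\to A[U]$ for $\phi$ with indeterminate $U$: (i) $\epsilon_0\circ\phi_U=\mathrm{id}_A$, where $\epsilon_0:A[U]\to A$ is evaluation at $U=0$; (ii) $\phi_V\circ\phi_U=\phi_{V+U}$, where $\phi_V:A\to A[V]$ is extended to $\phi_V: A[U]\to A[U,V]$ by $\phi_V(U)=U$. Its ring of invariants is $A^\phi=\{a\in A:\phi(a)=a\}$, and $\phi$ is nontrivial if $A^\phi\neq A$. A $k$-algebra is non-rigid if it admits a nontrivial exponential map, and rigid otherwise. *)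

(* Defs.v *)
From mathcomp Require Import all_boot all_algebra.
From mathcomp Require Import mpoly.

Set Implicit Arguments.
Unset Strict Implicit.
Unset Printing Implicit Defensive.

Import GRing.Theory.
Local Open Scope ring_scope.

(* C = R^[n]. *)
Definition is_poly_ring (n : nat) (R : comNzRingType) (C : comAlgType R) : Prop :=
  exists f : {lrmorphism {mpoly R[n]} -> C}, bijective f.

(* The scalings are parameters because an L-algebra is viewed below as a
   k-module by restriction of scalars, which is not a canonical instance. *)
Definition klinear (k : fieldType) (U V : zmodType)
    (sU : k -> U -> U) (sV : k -> V -> V) (g : U -> V) : Prop :=
  (forall x y, g (x + y) = g x + g y) /\ (forall c x, g (sU c x) = sV c (g x)).

Definition kbilinear (k : fieldType) (U U' V : zmodType)
    (sU : k -> U -> U) (sU' : k -> U' -> U') (sV : k -> V -> V)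
    (b : U -> U' -> V) : Prop :=
  (forall y, klinear sU sV (b^~ y)) /\ (forall x, klinear sU' sV (b x)).

Section BaseChange.
Variables (k L : fieldType) (iota : {rmorphism k -> L}).

Definition res_scale (M : lmodType L) (c : k) (x : M) : M := iota c *: x.

(* The L-algebra T, with a (x) l := tens a l, is the tensor product of A and L
   over k: [tens] is the universal k-bilinear map out of A x L, and T carries the
   usual multiplication and L-structure on pure tensors. *)
Definition is_tensor_product (A : comAlgType k) (T : comAlgType L)
    (tens : A -> L -> T) : Prop :=
  [/\ kbilinear ( *:%R) (@res_scale L^o) (@res_scale T) tens,
      forall (V : lmodType k) (b : A -> L -> V),
        kbilinear ( *:%R) (@res_scale L^o) ( *:%R) b ->
        exists2 g : T -> V,
          klinear (@res_scale T) ( *:%R) g /\ (forall a l, g (tens a l) = b a l)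
          & forall g' : T -> V,
              klinear (@res_scale T) ( *:%R) g' ->
              (forall a l, g' (tens a l) = b a l) -> g' =1 g,
      tens 1 1 = 1,
      forall a a' l l', tens a l * tens a' l' = tens (a * a') (l * l')
    & forall a l l', l' *: tens a l = tens a (l' * l)].

Definition is_affine_form (n : nat) (A : comAlgType k) : Prop :=
  exists (T : comAlgType L) (tens : A -> L -> T),
    is_tensor_product tens /\ is_poly_ring n T.

End BaseChange.

Section UFD.
Variable R : comNzRingType.

Definition invertible (x : R) : Prop := exists y, x * y = 1.

Definition irreducible_elt (p : R) : Prop :=
  [/\ p != 0, ~ invertible p
    & forall x y, p = x * y -> invertible x \/ invertible y].

Definition associated (x y : R) : Prop := exists2 u, invertible u & y = u * x.

Definition is_ufd : Prop :=
  [/\ GRing.integral_domain_axiom R,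
      forall x : R, x != 0 -> ~ invertible x ->
        exists2 s : seq R, (forall p, p \in s -> irreducible_elt p)
                           & x = \prod_(p <- s) p
    & forall s t : seq R,
        (forall p, p \in s -> irreducible_elt p) ->
        (forall p, p \in t -> irreducible_elt p) ->
        \prod_(p <- s) p = \prod_(p <- t) p ->
        exists t' : seq R,
          [/\ perm_eq t' t, size s = size t'
            & forall i, (i < size s)%N -> associated s`_i t'`_i]].

End UFD.

Section Exponential.
Variables (k : fieldType) (A : comAlgType k).

(* {poly A} has a canonical A-algebra structure only; the scaling
   [in_alg A \; *:%R] is its induced k-structure.  In the second law,
   A[U, V] is {poly {poly A}} with U the outer and V the inner variable:
   [map_poly phi] is phi_V extended by U |-> U, and [poly_XaY p] is the
   image of p(T) under T |-> U + V. *)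
Definition is_exponential_map
    (phi : {lrmorphism A -> {poly A} | in_alg A \; *:%R}) : Prop :=
  (forall a, (phi a).[0] = a) /\
  (forall a, map_poly phi (phi a) = poly_XaY (phi a)).

Definition invariant (phi : A -> {poly A}) (a : A) : Prop := phi a = a%:P.

Definition non_rigid : Prop :=
  exists phi : {lrmorphism A -> {poly A} | in_alg A \; *:%R},
    is_exponential_map phi /\ ~ (forall a, invariant phi a).

End Exponential.

Definition has_rational_point (k : fieldType) (A : comAlgType k) : Prop :=
  inhabited {lrmorphism A -> k^o}.

(* Main.v *)
(** Write B for the invariants of a nontrivial exponential map phi,
    and x for an element of least positive phi-degree. Division by powers of x
    shows that A[1/c] = B[1/c][x], where c in B is the leading coefficient of
    phi(x). As A embeds in L[X,Y], any two elements of B are algebraically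
    dependent over k; as B is factorially closed in the UFD A and carries a
    retraction to k, an irreducible f in B killed by the retraction divides every
    element of B killed by it, whence B = k[f].

    Choose x so that c has least degree in f. If A <> k[f,x], then some irreducible
    p in k[f] divides in A an element P(x) with P in k[f][T] not divisible by p.
    Let M be an extension of L with a root lambda of p and over which P at
    f = lambda splits. In A (x) M = M[X,Y] the element f - lambda is irreducible,
    hence prime, so it divides x - mu for some mu in M. By linear algebra over k
    this descends to x in k[f] + p A, contradicting the minimality of c. *)

Require Import Defs.
From HB Require Import structures.
From mathcomp Require Import all_boot all_algebra all_field.
From mathcomp Require boolp classical_sets.
From mathcomp Require Import mpoly ring zify.
Set Implicit Arguments.
Unset Strict Implicit.
Unset Printing Implicit Defensive.
Import GRing.Theory.
Local Open Scope ring_scope.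

(** * Separating functionals *)

(** Two obstacles shape the argument. In positive characteristic the least positive phi-degree [n]
    can exceed 1, so no derivation is available: the vanishing of binomial coefficients shows that
    [n] divides every phi-degree. Also, [lambda] may be inseparable over k and need not lie in L.
    Hence M is any extension, a single root is used, and A (x) M is never built: only functionals
    separating a vector from a k-subspace are carried from L to M.

    Irreducibility of f in A says nothing about f - lambda over M. What survives base change is a
    saturation property of k[f]: if r(f) u lies in M[f] with r nonzero over k, then u lies in M[f]
    ([evalf_factor]). Since u and v are polynomials in x over M(f), a factorization f - lambda = u v
    takes place in M[f], where X - lambda has degree 1.

    The contradiction with the choice of x is explicit: if x = b(f) + p(f) x', then x' has the same
    phi-degree as x, and the leading coefficients satisfy c = p(f) c'. *)

Section LinearFunctional.
Variables (K : fieldType) (U : lmodType K).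

Definition subspace (W : U -> Prop) :=
  W 0 /\ forall c u v, W u -> W v -> W (c *: u + v).

Lemma subspaceD W u v : subspace W -> W u -> W v -> W (u + v).
Proof. by case=> _ WP Wu Wv; have := WP 1 _ _ Wu Wv; rewrite scale1r. Qed.

Lemma subspaceZ W c u : subspace W -> W u -> W (c *: u).
Proof. by case=> W0 WP Wu; have := WP c _ _ Wu W0; rewrite addr0. Qed.

Lemma subspaceB W u v : subspace W -> W u -> W v -> W (u - v).
Proof.
by move=> sW Wu Wv; apply: subspaceD => //; rewrite -scaleN1r; apply: subspaceZ.
Qed.

Lemma maximal_subspace (W : U -> Prop) (v : U) : subspace W -> ~ W v ->
  exists2 H : U -> Prop, [/\ subspace H, forall u, W u -> H u & ~ H v]
    & forall H' : U -> Prop, subspace H' -> (forall u, H u -> H' u) -> ~ H' v ->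
      forall u, H' u -> H u.
Proof.
move=> sW Wv.
pose T := {H : U -> Prop | [/\ subspace H, forall u, W u -> H u & ~ H v]}.
pose R (H H' : T) : bool := boolp.asbool (forall u, sval H u -> sval H' u).
have [||||H maxH] := @classical_sets.Zorn T R.
- by move=> H; apply/boolp.asboolP.
- by move=> H1 H2 H3 /boolp.asboolP H12 /boolp.asboolP H23; apply/boolp.asboolP; auto.
- move=> [H1 H1P] [H2 H2P] /boolp.asboolP /= H12 /boolp.asboolP /= H21.
  apply: boolp.eq_exist; apply: boolp.funext => u; apply: boolp.propext.
  by split; auto.
- move=> F totF.
  have [[H0 FH0] | noF] := boolp.EM (exists H, F H); last first.
    by exists (exist _ W (And3 sW (fun u h => h) Wv)) => H FH; case: noF; exists H.
  pose G u := exists2 H : T, F H & sval H u.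
  have GP : [/\ subspace G, forall u, W u -> G u & ~ G v].
    split.
    - split=> [|c x y [H1 FH1 H1x] [H2 FH2 H2y]].
        by exists H0 => //; case: (svalP H0) => [[]].
      have [/boolp.asboolP le|/boolp.asboolP le] := totF _ _ FH1 FH2.
        by exists H2 => //; case: (svalP H2) => [[_ +] _ _]; apply; auto.
      by exists H1 => //; case: (svalP H1) => [[_ +] _ _]; apply; auto.
    - by move=> u Wu; exists H0 => //; case: (svalP H0) => [_ + _]; apply.
    - by case=> H _; case: (svalP H).
  exists (exist _ G GP) => H FH; apply/boolp.asboolP => u /= Hu.
  by exists H.
exists (sval H); first exact: (svalP H).
move=> H' sH' HH' H'v u H'u.
have H'P : [/\ subspace H', forall u, W u -> H' u & ~ H' v].
  by split=> // w Ww; apply: HH'; case: (svalP H) => _ + _; apply.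
have /(_ _)/(congr1 sval) /= := maxH (exist _ H' H'P).
by move=> <- //; apply/boolp.asboolP.
Qed.

(** A subspace [H] that contains [W] and is maximal among those avoiding [v] is a complement of the
    line spanned by [v]; the functional is the coordinate along [v]. *)
Lemma separating_functional (W : U -> Prop) (v : U) : subspace W -> ~ W v ->
  exists l : U -> K, [/\ forall c x y, l (c *: x + y) = c * l x + l y,
    forall x, W x -> l x = 0 & l v = 1].
Proof.
move=> sW Wv; have [H [sH WH Hv] maxH] := maximal_subspace sW Wv.
have ext u : exists t, H (u - t *: v).
  (* If no [t] works, adjoining [u] to [H] still avoids [v]; by maximality [u] lies in [H], and t =
     0 works after all. *)
  have [//|nu] := boolp.EM (exists t, H (u - t *: v)).
  pose H' w := exists2 h, H h & exists s, w = h + s *: u.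
  have sH' : subspace H'.
    split; first by exists 0; [case: sH | exists 0; rewrite scale0r addr0].
    move=> c _ _ [h1 Hh1 [s1 ->]] [h2 Hh2 [s2 ->]].
    exists (c *: h1 + h2); first by case: sH => _; apply.
    by exists (c * s1 + s2); rewrite scalerDr scalerDl scalerA addrACA.
  have HH' w : H w -> H' w by move=> Hw; exists w => //; exists 0; rewrite scale0r addr0.
  have H'v : ~ H' v.
    case=> h Hh [s vE]; have [s0|s0] := eqVneq s 0.
      by apply: Hv; rewrite vE s0 scale0r addr0.
    case: nu; exists s^-1; rewrite vE scalerDr scalerA mulVf // scale1r.
    by rewrite opprD addrCA subrr addr0 -scaleNr; apply: subspaceZ.
  case: nu; exists 0; rewrite scale0r subr0; apply: (maxH _ sH' HH' H'v).
  by exists 0; [case: sH | exists 1; rewrite scale1r add0r].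
pose l u := sval (boolp.cid (ext u)).
have lP u : H (u - l u *: v) := svalP (boolp.cid (ext u)).
have lE u t : H (u - t *: v) -> l u = t.
  move=> Ht; apply/eqP; rewrite -subr_eq0; apply/eqP.
  have [//|d0] := eqVneq (l u - t) 0.
  case: Hv; rewrite -[v]scale1r -(mulVf d0) -scalerA; apply: subspaceZ => //.
  have := subspaceB sH Ht (lP u).
  by rewrite opprB addrC addrA subrK scalerBl.
exists l; split.
- move=> c x y; apply: lE.
  have -> : c *: x + y - (c * l x + l y) *: v
    = c *: (x - l x *: v) + (y - l y *: v).
    by rewrite scalerBr scalerDl scalerA opprD addrACA.
  by case: sH => _; apply.
- by move=> x Wx; apply: lE; rewrite scale0r subr0; apply: WH.
- by apply: lE; rewrite scale1r subrr; case: sH.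
Qed.

End LinearFunctional.

(** * Base change to a polynomial ring in two variables *)

Section PolyForm.
Variables (M : fieldType) (R : nzRingType) (g : M -> R) (F : nat -> R -> M).
Hypothesis F_lin : forall i c x y, F i (g c * x + y) = c * F i x + F i y.

(** Applied first to R = M with [g] the identity, then to R = {poly M} with [g] = [polyC]: a
    functional on M[X, Y] is thus assembled one variable at a time. *)
Definition poly_form (p : {poly R}) : M := \sum_(i < size p) F i p`_i.

Lemma poly_form_widen n (p : {poly R}) : (size p <= n)%N ->
  poly_form p = \sum_(i < n) F i p`_i.
Proof.
move=> le_pn; rewrite /poly_form (big_ord_widen _ (fun i => F i p`_i) le_pn).
rewrite big_mkcond /=; apply: eq_bigr => i _; case: ltnP => // le_pi.
have := F_lin i 1 0 0; rewrite mulr0 addr0 mul1r nth_default //.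
by move/eqP; rewrite -{1}[F i 0]addr0 (inj_eq (addrI _)) => /eqP.
Qed.

Lemma poly_form_linear c (u v : {poly R}) :
  poly_form ((g c)%:P * u + v) = c * poly_form u + poly_form v.
Proof.
set n := maxn (size u) (size v).
have un : (size u <= n)%N by rewrite leq_maxl.
have vn : (size v <= n)%N by rewrite leq_maxr.
rewrite (@poly_form_widen n); last first.
  rewrite (leq_trans (size_polyD _ _)) // geq_max vn andbT.
  by rewrite mul_polyC (leq_trans (size_scale_leq _ _)).
rewrite (poly_form_widen un) (poly_form_widen vn) mulr_sumr -big_split /=.
by apply: eq_bigr => i _; rewrite coefD coefCM F_lin.
Qed.

End PolyForm.

(* A form of A (x)_k M = M[X, Y], with j a = a (x) 1, that passes to extensions
   of M without constructing a tensor product: functionals on A separating a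
   vector from a subspace extend to M[X, Y], which encodes flatness. *)
Definition base_change_plane (k M : fieldType) (s : {rmorphism k -> M})
    (A : comAlgType k) (j : {rmorphism A -> {poly {poly M}}}) : Prop :=
  [/\ forall c a, j (c *: a) = (s c)%:P%:P * j a,
      forall w, exists r : seq (M * A), w = \sum_(q <- r) q.1%:P%:P * j q.2
    & forall (W : A -> Prop) (v : A), subspace W -> ~ W v ->
        exists l : {poly {poly M}} -> M,
          [/\ forall c u w, l (c%:P%:P * u + w) = c * l u + l w,
              forall a, W a -> l (j a) = 0 & l (j v) = 1]].

Section FormTheory.
Variables (M : fieldType) (l : {poly {poly M}} -> M).
Hypothesis l_lin : forall c u w, l (c%:P%:P * u + w) = c * l u + l w.

Lemma plane_form0 : l 0 = 0.
Proof.
have := l_lin 1 0 0; rewrite mulr0 addr0 mul1r.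
by move/eqP; rewrite -{1}[l 0]addr0 (inj_eq (addrI _)) => /eqP.
Qed.

Lemma plane_formD u w : l (u + w) = l u + l w.
Proof. by have := l_lin 1 u w; rewrite !polyC1 !mul1r. Qed.

Lemma plane_formM c u : l (c%:P%:P * u) = c * l u.
Proof. by rewrite -[_ * u]addr0 l_lin plane_form0 addr0. Qed.

Lemma plane_form_sum (I : Type) (r : seq I) (P : pred I) (F : I -> {poly {poly M}}) :
  l (\sum_(i <- r | P i) F i) = \sum_(i <- r | P i) l (F i).
Proof.
elim: r => [|i r IH]; first by rewrite !big_nil plane_form0.
by rewrite !big_cons; case: (P i); rewrite ?plane_formD IH.
Qed.
End FormTheory.

(** A functional over L is extended to M[X, Y] by keeping its values on monomials. Spanning also
    reduces to monomials, which already lie in L[X, Y]. *)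
Lemma base_change_plane_ext (k L M : fieldType) (s : {rmorphism k -> L})
    (t : {rmorphism L -> M}) (A : comAlgType k)
    (j : {rmorphism A -> {poly {poly L}}}) :
  base_change_plane s j -> base_change_plane (t \o s) (map_poly (map_poly t) \o j).
Proof.
case=> jZ jS jE; split.
- by move=> c a /=; rewrite jZ rmorphM /= !map_polyC /= map_polyC.
- pose sp (u : {poly {poly M}}) := exists r : seq (M * A),
    u = \sum_(q <- r) q.1%:P%:P * map_poly (map_poly t) (j q.2).
  have mono c i i' : sp (c%:P%:P * ('X^i'%:P * 'X^i)).
    have [r rE] := jS ('X^i'%:P * 'X^i).
    exists [seq (c * t q.1, q.2) | q <- r].
    rewrite big_map -[_ * 'X^i](_ : map_poly (map_poly t) ('X^i'%:P * 'X^i) = _).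
      rewrite rE rmorph_sum mulr_sumr; apply: eq_bigr => q _ /=.
      by rewrite rmorphM /= !map_polyC /= map_polyC /= mulrA !polyCM.
    by rewrite rmorphM /= map_polyC /= !map_polyXn.
  have add (u v : {poly {poly M}}) : sp u -> sp v -> sp (u + v).
    by move=> [r ->] [r' ->]; exists (r ++ r'); rewrite big_cat.
  have zero : sp 0 by exists [::]; rewrite big_nil.
  move=> w; rewrite -/(sp w) -[w]coefK poly_def.
  elim/big_rec: _ => // i u _ IH; apply: (add _ _) => //.
  rewrite -mul_polyC -[w`_i]coefK poly_def rmorph_sum mulr_suml.
  elim/big_rec: _ => // i' u' _ IH'; apply: (add _ _) => //.
  by rewrite /= -mul_polyC polyCM -mulrA.
- move=> W v sW Wv; have [l [l_lin lW lv]] := jE W v sW Wv.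
  pose F2 i := poly_form (fun i' (c : M) => c * t (l ('X^i'%:P * 'X^i))).
  have F1_lin i i' (c x y : M) : (c * x + y) * t (l ('X^i'%:P * 'X^i))
      = c * (x * t (l ('X^i'%:P * 'X^i))) + y * t (l ('X^i'%:P * 'X^i)).
    by rewrite mulrDl mulrA.
  have F2_lin i c x y : F2 i (c%:P * x + y) = c * F2 i x + F2 i y.
    exact: (poly_form_linear (g := id) (F1_lin i)).
  pose lM := poly_form F2.
  have lM_lin c x y : lM (c%:P%:P * x + y) = c * lM x + lM y.
    exact: (poly_form_linear (g := polyC) F2_lin).
  have lME u : lM (map_poly (map_poly t) u) = t (l u).
    rewrite -[u in RHS]coefK poly_def (plane_form_sum l_lin) rmorph_sum.
    rewrite /lM (poly_form_widen (g := polyC) F2_lin (size_poly _ _)).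
    apply: eq_bigr => i _; rewrite coef_map /=.
    rewrite -mul_polyC -[u`_i in RHS]coefK poly_def rmorph_sum mulr_suml.
    rewrite (plane_form_sum l_lin) rmorph_sum.
    rewrite /F2 (poly_form_widen (g := id) (F1_lin i) (size_poly _ _)).
    apply: eq_bigr => i' _; rewrite coef_map /= -mul_polyC polyCM -mulrA.
    by rewrite (plane_formM l_lin) rmorphM.
  exists lM; split=> // [a Wa|] /=; rewrite lME; first by rewrite lW ?rmorph0.
  by rewrite lv rmorph1.
Qed.

(** An alias to carry the k-structure on an L-module: the universal property of the tensor product
    tests against k-modules, and it has to be applied to L itself. *)
Definition restricted (k L : fieldType) (iota : {rmorphism k -> L})
  (V : lmodType L) : Type := V.

Section RestrictScalars.
Variables (k L : fieldType) (iota : {rmorphism k -> L}) (V : lmodType L).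

HB.instance Definition _ := GRing.Zmodule.on (restricted iota V).

Let scale (c : k) (v : restricted iota V) : restricted iota V := iota c *: (v : V).

Fact restricted_scaleA a b v : scale a (scale b v) = scale (a * b) v.
Proof. by rewrite /scale scalerA rmorphM. Qed.
Fact restricted_scale1 : left_id 1 scale.
Proof. by move=> v; rewrite /scale rmorph1 scale1r. Qed.
Fact restricted_scaleDr : right_distributive scale +%R.
Proof. by move=> c u v; rewrite /scale scalerDr. Qed.
Fact restricted_scaleDl v : {morph scale^~ v : a b / a + b}.
Proof. by move=> a b; rewrite /scale rmorphD scalerDl. Qed.

HB.instance Definition _ := GRing.Zmodule_isLmodule.Build k (restricted iota V)
  restricted_scaleA restricted_scale1 restricted_scaleDr restricted_scaleDl.

End RestrictScalars.

(** * The isomorphism between L[X_0, X_1] and L[X][Y] *)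

Section PolyPlane.
Variable L : fieldType.

Definition plane_of_mpoly : {mpoly L[2]} -> {poly {poly L}} :=
  mmap (polyC \o polyC) (fun i : 'I_2 => if i == ord0 then 'X%:P else 'X).
HB.instance Definition _ := GRing.RMorphism.on plane_of_mpoly.

Definition mpoly_of_plane : {poly {poly L}} -> {mpoly L[2]} :=
  horner_eval 'X_(inord 1) \o map_poly (horner_eval 'X_ord0 \o map_poly (@mpolyC 2 L)).
HB.instance Definition _ := GRing.RMorphism.on mpoly_of_plane.

Lemma mpoly_of_planeC c : mpoly_of_plane c%:P%:P = c%:MP.
Proof.
by rewrite /mpoly_of_plane /= map_polyC /= /horner_eval hornerC map_polyC hornerC.
Qed.

Lemma plane_of_mpolyC c : plane_of_mpoly c%:MP = c%:P%:P.
Proof. by rewrite /plane_of_mpoly mmapC. Qed.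

Lemma plane_of_mpolyX i :
  plane_of_mpoly 'X_i = if i == ord0 then 'X%:P else 'X.
Proof. by rewrite /plane_of_mpoly mmapX mmap1U. Qed.

Lemma plane_of_mpolyK : cancel plane_of_mpoly mpoly_of_plane.
Proof.
move=> p; rewrite -[LHS]/((mpoly_of_plane \o plane_of_mpoly) p).
rewrite [RHS]mpolyE [p in LHS]mpolyE rmorph_sum.
apply: eq_bigr => m _ /=; rewrite -!mul_mpolyC !rmorphM /=.
rewrite plane_of_mpolyC mpoly_of_planeC; congr (_ * _).
rewrite /plane_of_mpoly mmapX /mmap1 mpolyXE_id rmorph_prod.
apply: eq_bigr => i _; rewrite rmorphXn; congr (_ ^+ _).
case: eqP => [->|/eqP i0].
  by rewrite /= /mpoly_of_plane /= map_polyC /= /horner_eval hornerC map_polyX hornerX.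
rewrite /= /mpoly_of_plane /= map_polyX /horner_eval hornerX; congr 'X_(_).
by apply: val_inj; rewrite /= inordK //; case: i i0 => [[|[|]]].
Qed.

Lemma mpoly_of_planeK : cancel mpoly_of_plane plane_of_mpoly.
Proof.
move=> w; rewrite /mpoly_of_plane /= /horner_eval.
rewrite -(horner_map plane_of_mpoly) /= -map_poly_comp.
rewrite plane_of_mpolyX.
rewrite ifN; last by rewrite -val_eqE /= inordK.
rewrite -[RHS](comp_polyXr w) /comp_poly; congr (_.[_]).
apply: eq_map_poly => p /=; rewrite /horner_eval.
rewrite -(horner_map plane_of_mpoly) /= -map_poly_comp.
rewrite plane_of_mpolyX eqxx.
have -> : map_poly (plane_of_mpoly \o @mpolyC 2 L) p = map_poly polyC (map_poly polyC p).
  by rewrite -map_poly_comp; apply: eq_map_poly => c /=; rewrite plane_of_mpolyC.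
by rewrite horner_map /= -/(comp_poly _ _) comp_polyXr.
Qed.

End PolyPlane.

(** * From a tensor product to separating functionals *)

Section TensorPlane.
Variables (k L : fieldType) (iota : {rmorphism k -> L}) (A : comAlgType k).
Variables (T : comAlgType L) (tens : A -> L -> T).
Hypothesis tensP : is_tensor_product iota tens.

Lemma tensE a l : tens a l = l *: tens a 1.
Proof. by case: tensP => _ _ _ _ ->; rewrite mulr1. Qed.

(** A functional that kills the span of the pure tensors agrees with 0 on all of them, so it is 0 by
    the uniqueness in the universal property; hence nothing can be separated from the span. *)
Lemma tens_span t : exists r : seq (L * A), t = \sum_(q <- r) q.1 *: tens q.2 1.
Proof.
pose W t := exists r : seq (L * A), t = \sum_(q <- r) q.1 *: tens q.2 1.
have sW : subspace W.
  split; first by exists [::]; rewrite big_nil.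
  move=> c _ _ [r1 ->] [r2 ->]; exists ([seq (c * q.1, q.2) | q <- r1] ++ r2).
  rewrite big_cat big_map scaler_sumr; congr (_ + _).
  by apply: eq_bigr => q _; rewrite scalerA.
have [//|Wt] := boolp.EM (W t).
have [l [l_lin lW lt]] := separating_functional sW Wt.
have l_tens a c : l (tens a c) = 0.
  by apply: lW; exists [:: (c, a)]; rewrite big_seq1 tensE.
have l0 : l 0 = 0 by apply: lW; case: sW.
have [_ univ _ _ _] := tensP.
have bil : kbilinear ( *:%R) (@res_scale k L iota L^o) ( *:%R)
    (fun (_ : A) (_ : L) => 0 : restricted iota L^o).
  by split=> ?; split=> *; rewrite ?addr0 ?scaler0.
have [g _ uniq_g] := univ (restricted iota L^o) _ bil.
have g_l : g =1 l.
  move=> x; apply/esym; apply: uniq_g => //; split=> [x' y|c x'].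
    by rewrite -{1}[x']scale1r l_lin mul1r.
  by rewrite /res_scale -[_ *: x']addr0 l_lin l0 addr0.
have g_0 : g =1 (fun=> 0).
  by move=> x; apply/esym; apply: uniq_g => //; split=> *; rewrite ?addr0 ?scaler0.
by have := oner_neq0 L; rewrite -lt -g_l g_0 eqxx.
Qed.

Lemma tens_functional (l0 : A -> k) :
  (forall c x y, l0 (c *: x + y) = c * l0 x + l0 y) ->
  exists2 l : T -> L, forall c x y, l (c *: x + y) = c * l x + l y
    & forall a, l (tens a 1) = iota (l0 a).
Proof.
move=> l0_lin; have [_ univ _ _ scal] := tensP.
have l00 : l0 0 = 0.
  have := l0_lin 1 0 0; rewrite scaler0 addr0 mul1r.
  by move/eqP; rewrite -{1}[l0 0]addr0 (inj_eq (addrI _)) => /eqP.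
have bil : kbilinear ( *:%R) (@res_scale k L iota L^o) ( *:%R)
    (fun (a : A) (c : L) => iota (l0 a) * c : restricted iota L^o).
  split=> [c|a]; split=> [x y|d x].
  - by rewrite -{1}[x]scale1r l0_lin mul1r rmorphD mulrDl.
  - by rewrite -[_ *: x]addr0 l0_lin l00 addr0 rmorphM -mulrA.
  - by rewrite mulrDr.
  - by rewrite /res_scale /= mulrCA.
have [g [[gD gZ] gT] _] := univ (restricted iota L^o) _ bil.
have g0 : g 0 = 0 by apply: (addrI (g 0)); rewrite -gD !addr0.
(* The universal property only makes [g] k-linear; L-linearity is checked on pure tensors, which
   span. *)
have gL c x : g (c *: x) = c * (g x : L).
  have [r ->] := tens_span x; rewrite scaler_sumr.
  elim: r => [|q r IH]; first by rewrite !big_nil g0 mulr0.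
  rewrite !big_cons !gD [RHS]mulrDr IH; congr (_ + _).
  by rewrite scalerA -!tensE !gT mulrCA.
exists g => [c x y|a]; first by rewrite gD gL.
by rewrite gT mulr1.
Qed.

(** The map [j] is a |-> a (x) 1 read in L[X][Y], and the required functional is l0 (x) id for a
    functional [l0] that separates over k. *)
Lemma tens_plane : is_poly_ring 2 T ->
  exists j : {rmorphism A -> {poly {poly L}}}, base_change_plane iota j.
Proof.
case=> f [g fK gK]; have [[bilA _] _ t11 tM _] := tensP.
have f_inj := can_inj fK.
have gD : {morph g : x y / x + y} by move=> x y; apply: f_inj; rewrite gK rmorphD /= !gK.
have gZ c x : g (c *: x) = c *: g x by apply: f_inj; rewrite gK linearZ /= gK.
have gM : {morph g : x y / x * y} by move=> x y; apply: f_inj; rewrite gK rmorphM /= !gK.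
have g1 : g 1 = 1 by apply: f_inj; rewrite rmorph1 gK.
have g0 : g 0 = 0 by apply: f_inj; rewrite rmorph0 gK.
pose j0 a := plane_of_mpoly (g (tens a 1)).
have j0D : {morph j0 : x y / x + y}.
  by move=> x y; rewrite /j0; case: (bilA 1) => -> _; rewrite gD rmorphD.
have j0B : zmod_morphism j0.
  by move=> x y; apply/eqP; rewrite eq_sym subr_eq -j0D subrK.
have j0M : monoid_morphism j0.
  split=> [|x y]; first by rewrite /j0 t11 g1 rmorph1.
  by rewrite /j0 -rmorphM -gM tM mulr1.
pose j : {rmorphism A -> {poly {poly L}}} :=
  HB.pack_for {rmorphism A -> {poly {poly L}}} j0
    (GRing.isZmodMorphism.Build _ _ j0 j0B) (GRing.isMonoidMorphism.Build _ _ j0 j0M).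
have pZ c x : plane_of_mpoly (c *: x) = c%:P%:P * plane_of_mpoly x.
  by rewrite -mul_mpolyC rmorphM /= plane_of_mpolyC.
exists j; split.
- move=> c a; rewrite /= /j0; case: (bilA 1) => _ ->.
  by rewrite /res_scale gZ pZ.
- move=> w; have [r rE] := tens_span (f (mpoly_of_plane w)); exists r.
  rewrite -[w in LHS]mpoly_of_planeK -[mpoly_of_plane w]fK rE.
  elim: r {rE} => [|q r IH]; first by rewrite !big_nil g0 rmorph0.
  by rewrite !big_cons gD rmorphD /= IH gZ pZ.
- move=> W v sW Wv; have [l0 [l0_lin l0W l0v]] := separating_functional sW Wv.
  have [l l_lin lE] := tens_functional l0_lin.
  have l_j a : l (f (mpoly_of_plane (j a))) = iota (l0 a).
    by rewrite /= /j0 plane_of_mpolyK gK lE.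
  exists (fun w => l (f (mpoly_of_plane w))); split=> [c u w|a Wa|].
  + by rewrite rmorphD rmorphM /= mpoly_of_planeC mul_mpolyC rmorphD /= linearZ /= l_lin.
  + by rewrite [LHS]l_j l0W ?rmorph0.
  + by rewrite [LHS]l_j l0v rmorph1.
Qed.

End TensorPlane.

(** * Exponential maps and elements of least positive degree *)

(** Taylor expansion of p(U + V) in powers of the outer variable U. The coefficients are Hasse
    derivatives, so no factorial has to be inverted. *)
Lemma coef_poly_XaY (R : comNzRingType) (p : {poly R}) i :
  (poly_XaY p)`_i = p^`N(i).
Proof.
have eY (q : {poly R}) : (map_poly polyC q^:P).['X%:P] = q%:P.
  by rewrite horner_map /= -/(comp_poly _ _) comp_polyXr.
have -> : poly_XaY p = \sum_(l < size p) p^`N(l)%:P * 'X^l.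
  rewrite /poly_XaY /comp_poly addrC nderiv_taylor; last exact: mulrC.
  rewrite !size_map_polyC; apply: eq_bigr => l _.
  by rewrite !nderivn_map /= eY.
rewrite coef_sum; have [lt_ip|le_pi] := ltnP i (size p).
  rewrite (bigD1 (Ordinal lt_ip)) //= coefCM coefXn eqxx mulr1 big1 ?addr0 //.
  move=> l /negPf; rewrite -val_eqE /= => li.
  by rewrite coefCM coefXn eq_sym li mulr0.
rewrite nderivn_poly0 // big1 // => l _; rewrite coefCM coefXn.
by rewrite gtn_eqF ?mulr0 // (leq_trans (ltn_ord l)).
Qed.

Section Domain.
Variable A : comNzRingType.
Hypothesis domA : GRing.integral_domain_axiom A.
Implicit Types p q : {poly A}.

Lemma domM_eq0 (x y : A) : (x * y == 0) = (x == 0) || (y == 0).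
Proof.
apply/eqP/idP; first exact: domA.
by case/orP=> /eqP->; rewrite ?mul0r ?mulr0.
Qed.

Lemma domM_neq0 (x y : A) : x != 0 -> y != 0 -> x * y != 0.
Proof. by rewrite domM_eq0 negb_or => -> ->. Qed.

Lemma domX_neq0 (x : A) n : x != 0 -> x ^+ n != 0.
Proof.
move=> x0; elim: n => [|n IH]; first exact: oner_neq0.
by rewrite exprS domM_neq0.
Qed.

Lemma domI (x y z : A) : x != 0 -> x * y = x * z -> y = z.
Proof.
move=> x0 /eqP; rewrite -subr_eq0 -mulrBr domM_eq0 (negPf x0) subr_eq0.
by move/eqP.
Qed.

Lemma dom_lead_coefM p q : lead_coef (p * q) = lead_coef p * lead_coef q.
Proof.
have [->|p0] := eqVneq p 0; first by rewrite mul0r lead_coef0 mul0r.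
have [->|q0] := eqVneq q 0; first by rewrite mulr0 lead_coef0 mulr0.
by rewrite lead_coef_proper_mul // domM_neq0 ?lead_coef_eq0.
Qed.

Lemma dom_lead_coefX p n : lead_coef (p ^+ n) = lead_coef p ^+ n.
Proof.
elim: n => [|n IH]; first by rewrite !expr0 lead_coef1.
by rewrite !exprS dom_lead_coefM IH.
Qed.

Lemma dom_size_mul p q : p != 0 -> q != 0 ->
  size (p * q) = (size p + size q).-1.
Proof. by move=> p0 q0; rewrite size_proper_mul // domM_neq0 ?lead_coef_eq0. Qed.

Lemma dom_size_exp p n : p != 0 -> size (p ^+ n) = ((size p).-1 * n).+1.
Proof.
move=> p0; have pn0 m : p ^+ m != 0.
  by rewrite -lead_coef_eq0 dom_lead_coefX domX_neq0 // lead_coef_eq0.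
elim: n => [|n IH]; first by rewrite expr0 size_poly1 muln0.
rewrite exprS dom_size_mul // IH addnS mulnS /= -[in LHS](@prednK (size p)) //.
by rewrite size_poly_gt0.
Qed.

End Domain.

(** * Local slices in arbitrary characteristic *)

Section Slice.
Variables (A : comNzRingType) (phi : {rmorphism A -> {poly A}}).
Hypothesis domA : GRing.integral_domain_axiom A.
Hypothesis phi0 : forall a, (phi a).[0] = a.
Hypothesis phiD : forall a, map_poly phi (phi a) = poly_XaY (phi a).
Hypothesis nontriv : ~ (forall a, phi a = a%:P).

Definition fixed (a : A) := phi a = a%:P.

Lemma fixedP a : (size (phi a) <= 1)%N -> fixed a.
Proof.
move/size1_polyC => e; rewrite /fixed [LHS]e; congr _%:P.
by rewrite -[RHS]phi0 [in RHS]e hornerC.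
Qed.

Lemma fixed_size a : fixed a -> (size (phi a) <= 1)%N.
Proof. by move->; rewrite size_polyC leq_b1. Qed.

Lemma phi_eq0 a : (phi a == 0) = (a == 0).
Proof.
apply/eqP/eqP=> [e|->]; last exact: rmorph0.
by rewrite -(phi0 a) e horner0.
Qed.

Lemma fixed0 : fixed 0. Proof. by rewrite /fixed rmorph0. Qed.
Lemma fixed1 : fixed 1. Proof. by rewrite /fixed rmorph1. Qed.
Lemma fixedD a b : fixed a -> fixed b -> fixed (a + b).
Proof. by rewrite /fixed => ea eb; rewrite rmorphD ea eb polyCD. Qed.
Lemma fixedN a : fixed a -> fixed (- a).
Proof. by rewrite /fixed => ea; rewrite rmorphN ea polyCN. Qed.
Lemma fixedM a b : fixed a -> fixed b -> fixed (a * b).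
Proof. by rewrite /fixed => ea eb; rewrite rmorphM ea eb polyCM. Qed.
Lemma fixedX a n : fixed a -> fixed (a ^+ n).
Proof. by rewrite /fixed => ea; rewrite rmorphXn ea polyC_exp. Qed.

(** Phi-degrees add up because A is a domain. This is the factorial closedness of the invariants. *)
Lemma fixed_factor a b : a * b != 0 -> fixed (a * b) -> fixed a.
Proof.
rewrite domM_eq0 // negb_or => /andP[a0 b0] /fixed_size.
rewrite rmorphM dom_size_mul ?phi_eq0 // => le1; apply: fixedP.
have: (0 < size (phi b))%N by rewrite size_poly_gt0 phi_eq0.
by move: le1; case: (size (phi a)) (size (phi b)) => [|[|m]] [|m'] //; rewrite addnS.
Qed.

Lemma fixed_factor_l a b : a != 0 -> fixed a -> fixed (a * b) -> fixed b.
Proof.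
move=> a0 ia iab; have [->|b0] := eqVneq b 0; first exact: fixed0.
by apply: (@fixed_factor b a); rewrite mulrC // domM_neq0.
Qed.

Lemma phi_coef a i : phi ((phi a)`_i) = nderivn i (phi a).
Proof. by rewrite -coef_poly_XaY -phiD coef_map. Qed.

Lemma size_phi_coef a i : (size (phi ((phi a)`_i)%R) <= size (phi a) - i)%N.
Proof.
rewrite phi_coef; apply/leq_sizeP => l le_l; rewrite coef_nderivn nth_default ?mul0rn //.
by rewrite -leq_subLR.
Qed.

(** Sizes are degrees plus one: the last clause says that elements of phi-degree below [n] are
    invariant, so [n] is the least positive phi-degree. *)
Definition slice n x :=
  [/\ (0 < n)%N, size (phi x) = n.+1
    & forall a, (size (phi a) <= n)%N -> fixed a].

Lemma slice_ex : exists n x, slice n x.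
Proof.
have ex : exists n, boolp.asbool (exists2 a, ~ fixed a & size (phi a) = n.+1).
  apply: boolp.contrapT => no; apply: nontriv => a; apply: boolp.contrapT => na.
  apply: no; exists (size (phi a)).-1; apply/boolp.asboolP; exists a => //.
  rewrite prednK // size_poly_gt0 phi_eq0; apply/eqP => a0.
  by apply: na; rewrite a0; apply: fixed0.
have [n /boolp.asboolP[x nx sx] minn] := ex_minnP ex.
exists n, x; split=> //.
  by case: n sx {minn} => // sx; case: nx; apply: fixedP; rewrite sx.
move=> a sa; apply: boolp.contrapT => na.
have sa0 : (0 < size (phi a))%N.
  rewrite size_poly_gt0 phi_eq0; apply/eqP => a0.
  by apply: na; rewrite a0; apply: fixed0.
have := minn (size (phi a)).-1; rewrite -ltnS prednK // ltnNge sa.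
by move=> h; suff: false by []; apply: h; apply/boolp.asboolP; exists a; rewrite ?prednK.
Qed.

Section FixedSlice.
Variables (n : nat) (x : A).
Hypothesis slx : slice n x.
Let c := lead_coef (phi x).

Lemma slice_gt0 : (0 < n)%N. Proof. by case: slx. Qed.
Lemma slice_size : size (phi x) = n.+1. Proof. by case: slx. Qed.

Lemma slice_lead_neq0 : c != 0.
Proof. by rewrite lead_coef_eq0 -size_poly_gt0 slice_size. Qed.

Lemma slice_coef_inv i : (0 < i)%N -> fixed (phi x)`_i.
Proof.
case: slx => n0 sx minx i0; apply: minx.
apply: leq_trans (size_phi_coef _ _) _; rewrite sx leq_subLR.
by rewrite -addn1 addnC leq_add2r.
Qed.

Lemma slice_lead_inv : fixed c.
Proof. by rewrite /c lead_coefE slice_size; apply: slice_coef_inv slice_gt0. Qed.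

(** The coefficient of index i in [phi x] is invariant, so the i-th Hasse derivative of [phi x] is
    constant; its coefficient of index n - i > 0 is C(n, i) c. *)
Lemma slice_bin i : (0 < i < n)%N -> 'C(n, i)%:R = 0 :> A.
Proof.
case/andP=> i0 lt_in.
have := phi_coef x i; rewrite slice_coef_inv //.
move/(congr1 (fun p : {poly A} => p`_(n - i))).
rewrite coefC coef_nderivn subnKC ?(ltnW lt_in) //.
rewrite subn_eq0 leqNgt lt_in /= => /esym/eqP.
rewrite -[X in X == 0]mulr_natr (domM_eq0 domA).
have -> : (phi x)`_n = c by rewrite /c lead_coefE slice_size.
by rewrite (negPf slice_lead_neq0) => /eqP.
Qed.

Lemma slice_exprD : (1 + 'X) ^+ n = 1 + 'X^n :> {poly A}.
Proof.
case: (n) slice_gt0 slice_bin => // m _ binm.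
rewrite exprDn big_ord_recl big_ord_recr /= big1 => [|i _].
  by rewrite add0r /bump /= !add1n subn0 subnn !expr1n bin0 binn !mulr1n !mul1r expr0.
rewrite -mulr_natr -(rmorph_nat polyC) /bump /= add1n binm ?polyC0 ?mulr0 //.
by rewrite /= ltnS; apply: (valP i).
Qed.

(** Read the coefficient of index r < n in (1 + X)^(q n + r) = (1 + X^n)^q (1 + X)^r, where the
    first factor is 1 modulo X^n. *)
Lemma slice_bin1 q r : (r < n)%N -> 'C(q * n + r, r)%:R = 1 :> A.
Proof.
move=> lt_rn.
have coefX1 m l : ((1 + 'X) ^+ m : {poly A})`_l = 'C(m, l)%:R.
  rewrite exprDn coef_sum; have [lt_lm|le_ml] := ltnP l m.+1; last first.
    rewrite bin_small // big1 // => i _; rewrite expr1n mul1r coefMn coefXn.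
    by rewrite gtn_eqF ?mul0rn // (leq_trans (ltn_ord i)).
  rewrite (bigD1 (Ordinal lt_lm)) //= big1 ?addr0 => [|i /negPf].
    by rewrite expr1n mul1r coefMn coefXn eqxx.
  by rewrite -val_eqE /= expr1n mul1r coefMn coefXn eq_sym => ->; rewrite mul0rn.
rewrite -coefX1 exprD mulnC exprM slice_exprD.
have [u ->] : exists u, (1 + 'X^n) ^+ q = 1 + 'X^n * u :> {poly A}.
  elim: q => [|q [u IH]]; first by exists 0; rewrite mulr0 addr0.
  exists (1 + 'X^n * u + u); rewrite exprS IH mulrDl mul1r !mulrDr.
  by rewrite -!addrA; congr (_ + _); rewrite addrC mulr1 -!addrA.
rewrite mulrDl mul1r coefD coefX1 binn -mulrA coefXnM lt_rn.
by rewrite addr0.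
Qed.

(* If r = deg a mod n were positive, the coefficient of index deg a - r of phi a
   would have degree exactly r < n, since C(deg a, r) = 1 by [slice_bin1]. *)
Lemma slice_dvd a : (n %| (size (phi a)).-1)%N.
Proof.
set m := (size (phi a)).-1; apply/negPn/negP => ndvd.
set r := (m %% n)%N; set q := (m %/ n)%N.
have mE : m = (q * n + r)%N := divn_eq m n.
have r0 : (0 < r)%N by rewrite lt0n.
have rn : (r < n)%N by rewrite ltn_mod slice_gt0.
have m0 : (0 < m)%N by rewrite mE addn_gt0 r0 orbT.
have sa : size (phi a) = m.+1 by rewrite /m; move: m0; rewrite /m; case: (size _).
have a'i : fixed (phi a)`_(q * n).
  case: slx => _ _; apply; apply: leq_trans (size_phi_coef _ _) _.
  by rewrite sa mE leq_subLR -addnS leq_add2l.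
have := phi_coef a (q * n); rewrite a'i => /(congr1 (fun p : {poly A} => p`_r)).
rewrite coefC coef_nderivn -mE gtn_eqF //.
have -> : 'C(m, q * n) = 'C(m, r).
  by rewrite -bin_sub ?mE ?leq_addr // addKn.
rewrite -mulr_natr {2}mE slice_bin1 // mulr1 => /esym/eqP.
have -> : (phi a)`_m = lead_coef (phi a) by rewrite lead_coefE sa.
by rewrite lead_coef_eq0 -size_poly_eq0 sa.
Qed.

Lemma phi_lead_inv a : fixed (lead_coef (phi a)).
Proof.
apply: fixedP; rewrite lead_coefE; apply: leq_trans (size_phi_coef _ _) _.
by rewrite leq_subLR addn1 leqSpred.
Qed.

Lemma phi_horner_inv (P : {poly A}) : (forall i, fixed P`_i) ->
  phi P.[x] = P \Po phi x.
Proof.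
move=> Pi; rewrite -horner_map /comp_poly; congr _.[_].
by apply/polyP => i; rewrite !coef_map /= Pi.
Qed.

Lemma slice_cover a : exists N, exists2 P : {poly A},
  forall i, fixed P`_i & c ^+ N * a = P.[x].
Proof.
have [m] := ubnP (size (phi a)); elim: m a => // m IH a; rewrite ltnS => le_m.
have [|gt1] := leqP (size (phi a)) 1.
  move/fixedP => ia; exists 0; exists a%:P; last by rewrite mul1r hornerC.
  by move=> i; rewrite coefC; case: eqP => // _; apply: fixed0.
have /dvdnP[q qE] := slice_dvd a.
have sa : size (phi a) = (q * n).+1 by rewrite -qE prednK // ltnW.
have a0 : phi a != 0 by rewrite -size_poly_gt0 sa.
set b := lead_coef (phi a).
have b0 : b != 0 by rewrite lead_coef_eq0.
have ib : fixed b by apply: phi_lead_inv.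
have x0 : phi x != 0 by rewrite -size_poly_gt0 slice_size.
(* Under [phi] both terms have degree q n and leading coefficient c^q b, so the degree drops. *)
pose a' := c ^+ q * a - b * x ^+ q.
have phia' : phi a' = (c ^+ q)%:P * phi a - b%:P * phi x ^+ q.
  by rewrite rmorphB !rmorphM !rmorphXn /= slice_lead_inv ib.
have cq0 : c ^+ q != 0 by rewrite domX_neq0 ?slice_lead_neq0.
have sa' : (size (phi a') < m)%N.
  apply: leq_trans le_m; rewrite sa ltnS; apply/leq_sizeP => i le_i.
  rewrite phia' coefB !coefCM.
  have sxq : size (phi x ^+ q) = (q * n).+1.
    by rewrite dom_size_exp // slice_size mulnC.
  have [->|ne] := eqVneq i (q * n)%N.
    have -> : (phi a)`_(q * n) = b by rewrite /b lead_coefE sa.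
    have -> : (phi x ^+ q)`_(q * n) = c ^+ q.
      by rewrite -dom_lead_coefX // lead_coefE sxq.
    by rewrite mulrC subrr.
  rewrite !nth_default ?mulr0 ?subr0 // ?sxq ?sa ltn_neqAle eq_sym ne //.
have [N [P Pi PE]] := IH _ sa'.
exists (N + q)%N; exists (P + (c ^+ N * b)%:P * 'X^q).
  move=> i; rewrite coefD coefCM coefXn; apply: fixedD => //.
  apply: fixedM; first by apply: fixedM => //; apply: fixedX slice_lead_inv.
  by case: eqP => _; [apply: fixed1|apply: fixed0].
rewrite hornerD hornerM hornerC hornerXn -PE /a' mulrBr -!mulrA.
by rewrite exprD mulrA subrK mulrA.
Qed.

(** For P of degree d with invariant coefficients, phi(P(x)) = P(phi x) has in degree n d the
    coefficient lead(P) c^d, which is nonzero if P is. *)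
Lemma slice_transcendental (P : {poly A}) : (forall i, fixed P`_i) ->
  P.[x] = 0 -> P = 0.
Proof.
move=> Pi Px; apply/eqP; apply/negPn/negP => P0.
have : phi P.[x] = 0 by rewrite Px rmorph0.
rewrite phi_horner_inv // comp_polyE.
have sP : size P = (size P).-1.+1 by rewrite prednK // size_poly_gt0.
have x0 : phi x != 0 by rewrite -size_poly_gt0 slice_size.
rewrite sP big_ord_recr /= => /(congr1 (fun p : {poly A} => p`_(n * (size P).-1))).
rewrite coefD coef_sum big1 => [|i _].
  rewrite add0r coefZ coef0 -lead_coefE.
  have -> : (phi x ^+ (size P).-1)`_(n * (size P).-1) = c ^+ (size P).-1.
    by rewrite -dom_lead_coefX // lead_coefE dom_size_exp // slice_size.
  move/eqP; rewrite domM_eq0 // lead_coef_eq0 (negPf P0) /=.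
  by apply/negP; rewrite domX_neq0 // slice_lead_neq0.
rewrite coefZ [X in _ * X]nth_default ?mulr0 // dom_size_exp // slice_size.
by rewrite ltn_pmul2l ?slice_gt0.
Qed.

End FixedSlice.
End Slice.

(** * Unique factorization in M[X, Y] *)

Section FieldPoly.
Variable F : fieldType.
Implicit Types p q : {poly F}.

Lemma exists_irredp p : (1 < size p)%N ->
  exists2 q, irreducible_poly q & q %| p.
Proof.
have [n] := ubnP (size p); elim: n p => // n IH p; rewrite ltnS => le_n gt1.
have [irr|red] := boolp.EM (irreducible_poly p); first by exists p.
have [d [d1 dp dnp]] : exists d : {poly F}, [/\ size d != 1, d %| p & ~~ (d %= p)].
  apply: boolp.contrapT => no; apply: red; split=> // d d1 dp.
  by apply: boolp.contrapT => /negP nd; apply: no; exists d.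
have p0 : p != 0 by rewrite -size_poly_gt0 ltnW.
have d0 : d != 0 by apply: contraTneq dp => ->; rewrite dvd0p.
have lt_dp : (size d < size p)%N.
  rewrite ltn_neqAle dvdp_leq // andbT.
  by apply: contra dnp => /eqP e; rewrite -dvdp_size_eqp // e.
have d_gt1 : (1 < size d)%N by rewrite ltn_neqAle eq_sym d1 size_poly_gt0.
have [q irr_q qd] := IH d (leq_trans lt_dp le_n) d_gt1.
by exists q => //; apply: dvdp_trans dp.
Qed.

Lemma irredp_ker (E : fieldType) (f : {rmorphism F -> E}) p q z :
  irreducible_poly p -> root (map_poly f p) z -> root (map_poly f q) z -> p %| q.
Proof.
move=> irr_p pz qz; apply: contraLR qz => npq.
have: coprimep p q by rewrite irreducible_poly_coprime.
by rewrite -(coprimep_map f) => cop; apply: coprimep_root cop pz.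
Qed.

Lemma exists_root p : (1 < size p)%N ->
  exists (E : fieldType) (f : {rmorphism F -> E}) (z : E), root (map_poly f p) z.
Proof.
case/exists_irredp=> q irr_q qp.
have [E _ [z qz _]] := irredp_FAdjoin irr_q.
have /dvdpP[r ->] := qp.
by exists E, (in_alg E), z; rewrite rmorphM rootM qz orbT.
Qed.

End FieldPoly.

Lemma exists_splitting (F : fieldType) (p : {poly F}) : p != 0 ->
  exists (E : fieldType) (f : {rmorphism F -> E}) (rs : seq E),
    map_poly f p = f (lead_coef p) *: \prod_(z <- rs) ('X - z%:P).
Proof.
have [n] := ubnP (size p); elim: n F p => // n IH F p; rewrite ltnS => le_n p0.
have [le1|gt1] := leqP (size p) 1.
  exists F, idfun, [::]; rewrite big_nil alg_polyC map_poly_id //.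
  by rewrite [LHS]size1_polyC // [in RHS](size1_polyC le1) lead_coefC.
have [E [f [z pz]]] := exists_root gt1.
have /factor_theorem[q qE] := pz.
have q0 : q != 0.
  by apply/eqP => q0; move: p0; rewrite -(map_poly_eq0 f) qE q0 mul0r eqxx.
have sq : (size q < n)%N.
  apply: leq_trans le_n; have := congr1 (fun p : {poly E} => size p) qE.
  by rewrite size_map_poly size_Mmonic ?monicXsubC // size_XsubC addn2 /= => ->.
have [E' [f' [rs rsE]]] := IH E q sq q0.
exists E', (f' \o f), (f' z :: rs).
rewrite map_poly_comp qE rmorphM /= rsE big_cons rmorphB /= map_polyX map_polyC /=.
have -> : lead_coef q = f (lead_coef p).
  by rewrite -lead_coef_map qE lead_coef_Mmonic // monicXsubC.
by rewrite -scalerAl mulrC.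
Qed.

Section PlaneUFD.
Variable M : fieldType.
Implicit Types (p q c : {poly M}) (u v w h : {poly {poly M}}).

Lemma polyC_dvd p u : (forall i, p %| u`_i) -> exists u', u = p%:P * u'.
Proof.
move=> pu; exists (map_poly (fun a => a %/ p) u); apply/polyP => i.
by rewrite coefCM coef_map_id0 ?div0p // mulrC divpK.
Qed.

(* Reduction mod p lands in the polynomials over an extension field of M, a domain. *)
Lemma irredp_polyC_prime p u v w : irreducible_poly p -> u * v = p%:P * w ->
  (exists u', u = p%:P * u') \/ (exists v', v = p%:P * v').
Proof.
move=> irr_p uvE; have [E _ [z pz _]] := irredp_FAdjoin irr_p.
pose ev := horner_eval z \o map_poly (in_alg E).
have evP q : ev q = 0 -> p %| q by move=> e; apply: (irredp_ker irr_p pz); apply/rootP.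
have : map_poly ev u * map_poly ev v = 0.
  by rewrite -rmorphM uvE rmorphM /= map_polyC /= /horner_eval (rootP pz) mul0r.
have co (u1 : {poly {poly M}}) : map_poly ev u1 = 0 -> exists u', u1 = p%:P * u'.
  move=> e; apply: polyC_dvd => i; apply: evP.
  by have := congr1 (fun q : {poly E} => q`_i) e; rewrite coef0 coef_map.
by move/eqP; rewrite mulf_eq0 => /orP[/eqP /co|/eqP /co]; [left|right].
Qed.

(** The units of M[X][Y] are the nonzero constants. They satisfy this definition too, which is
    harmless below since they divide everything. *)
Definition plane_irreducible h := forall u v, h = u * v ->
  (exists2 c : M, c != 0 & u = c%:P%:P) \/ (exists2 c : M, c != 0 & v = c%:P%:P).

(** A form of Gauss's lemma: each irreducible factor of [c] is prime in M[X][Y], so it can be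
    cancelled from [u] or from [v]. *)
Lemma polyC_mul_factor c h u v : c != 0 -> c%:P * h = u * v ->
  exists c1 c2 u' v',
    [/\ c1 != 0, c2 != 0, u = c1%:P * u', v = c2%:P * v' & h = u' * v'].
Proof.
have [n] := ubnP (size c); elim: n c u v => // n IH c u v; rewrite ltnS => le_n c0 e.
have [le1|gt1] := leqP (size c) 1.
  have [a cE] : exists a, c = a%:P by exists c`_0; apply: size1_polyC.
  have a0 : a != 0 by move: c0; rewrite cE polyC_eq0.
  exists c, 1, (a^-1%:P%:P * u), v; split=> //; first exact: oner_neq0.
  - by rewrite cE mulrA -!polyCM mulfV // mul1r.
  - by rewrite mul1r.
  - by rewrite -mulrA -e cE mulrA -!polyCM mulVf // mul1r.
have [p irr_p /dvdpP[c' cE]] := exists_irredp gt1.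
have p0 := irredp_neq0 irr_p.
have c'0 : c' != 0 by apply: contraNneq c0 => c'0; rewrite cE c'0 mul0r.
have sc' : (size c' < n)%N.
  apply: leq_trans le_n; rewrite cE size_mul // -subn1 -addnBA; last first.
    by rewrite ltnW //; case: irr_p.
  by rewrite -addn1 leq_add2l subn_gt0; case: irr_p.
have pP0 : p%:P != 0 by rewrite polyC_eq0.
have e' : u * v = p%:P * (c'%:P * h) by rewrite -e cE polyCM mulrA [c'%:P * _]mulrC.
have [[u1 uE]|[v1 vE]] := irredp_polyC_prime irr_p e'.
  have /(mulfI pP0) e1 : p%:P * (c'%:P * h) = p%:P * (u1 * v) by rewrite -e' uE mulrA.
  have [c1 [c2 [u' [v' [c10 c20 u1E vE hE]]]]] := IH c' u1 v sc' c'0 e1.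
  exists (p * c1), c2, u', v'; split=> //; first exact: mulf_neq0.
  by rewrite uE u1E polyCM mulrA.
have /(mulfI pP0) e1 : p%:P * (c'%:P * h) = p%:P * (u * v1).
  by rewrite -e' vE mulrCA.
have [c1 [c2 [u' [v' [c10 c20 uE v1E hE]]]]] := IH c' u v1 sc' c'0 e1.
exists c1, (p * c2), u', v'; split=> //; first exact: mulf_neq0.
by rewrite vE v1E polyCM mulrA.
Qed.

(** An irreducible [h] of positive Y-degree has no nonconstant factor in M[X], so all of [c] but a
    constant is absorbed by [s]. *)
Lemma plane_irreducible_cancel c h u s : plane_irreducible h -> (1 < size h)%N ->
  c != 0 -> c%:P * u = h * s -> exists u', u = h * u'.
Proof.
move=> irr_h gt1 c0 /(polyC_mul_factor c0)[c1 [c2 [h' [s' [c10 _ hE _ uE]]]]].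
have [[a a0 ac1]|[a a0 ac1]] := irr_h _ _ hE; last first.
  by move: gt1; rewrite hE ac1 -polyCM size_polyC; case: eqP.
exists (a^-1%:P%:P * s'); rewrite uE hE ac1 mulrACA -!polyCM mulfV //.
by rewrite mul1r.
Qed.

Lemma plane_irreducible_prime h u v w : h != 0 -> plane_irreducible h ->
  u * v = h * w -> (exists u', u = h * u') \/ (exists v', v = h * v').
Proof.
move=> h0 irr_h e.
have [le1|gt1] := leqP (size h) 1.
  have [p hE] : exists p, h = p%:P by exists h`_0; apply: size1_polyC.
  have p0 : p != 0 by move: h0; rewrite hE polyC_eq0.
  have [le1p|gt1p] := leqP (size p) 1.
    have [a pE] : exists a, p = a%:P by exists p`_0; apply: size1_polyC.
    have a0 : a != 0 by move: p0; rewrite pE polyC_eq0.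
    left; exists (a^-1%:P%:P * u).
    by rewrite hE pE mulrA -!polyCM mulfV // mul1r.
  rewrite hE in e *; apply: irredp_polyC_prime e; split=> // q q1 qp.
  have /dvdpP[r pE] := qp.
  have : h = r%:P * q%:P by rewrite hE pE polyCM.
  case/irr_h=> -[a a0 /polyC_inj aE].
    by rewrite pE aE mul_polyC eqp_sym eqp_scale.
  by move: q1; rewrite aE size_polyC a0.
(* From here [h] has positive Y-degree. The gcd is that of M(X)[Y], so divisibility holds up to a
   factor in M[X], removed by Gauss's lemma. Either [g] is [h] up to such factors and [h] divides
   [u], or [g] lies in M[X] and [h] divides [v]. *)
set g := gcdp h u.
have gh : g %| h := Pdiv.Idomain.dvdp_gcdl h u.
have gu : g %| u := Pdiv.Idomain.dvdp_gcdr h u.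
have [[c q] /= c0] := Pdiv.Idomain.dvdpP _ _ gh; rewrite -mul_polyC => cE.
have [c1 [c2 [q' [g' [_ c20 _ gE hE]]]]] := polyC_mul_factor c0 cE.
have [[a a0 aE]|[a a0 aE]] := irr_h _ _ hE.
  left; have [[b r] /= b0] := Pdiv.Idomain.dvdpP _ _ gu; rewrite -mul_polyC => bE.
  apply: (@plane_irreducible_cancel b h u (c2%:P * a^-1%:P%:P * r)) => //.
  have aV : a%:P%:P * a^-1%:P%:P = 1 :> {poly {poly M}} by rewrite -!polyCM mulfV.
  by rewrite bE gE hE aE -[LHS]mul1r -aV; ring.
right.
have sg : size g = 1%N.
  by rewrite gE aE -polyCM size_polyC mulf_neq0 ?polyC_eq0.
have cop : Pdiv.Idomain.coprimep h u by rewrite Pdiv.Idomain.coprimep_def -/g sg.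
have : h %| u * v by rewrite e Pdiv.Idomain.dvdp_mulr.
rewrite Pdiv.Idomain.Gauss_dvdpr // => hv.
have [[b r] /= b0] := Pdiv.Idomain.dvdpP _ _ hv; rewrite -mul_polyC => bE.
by apply: (@plane_irreducible_cancel b h v r) => //; rewrite bE mulrC.
Qed.
End PlaneUFD.

(** * Algebraic dependence *)

Section Counting.
Variable L : fieldType.
Implicit Types u v w : {poly {poly L}}.

Definition bidegree_le D u :=
  (size u <= D.+1)%N && (size (swapXY u) <= D.+1)%N.

Lemma bidegree_le1 : bidegree_le 0 1.
Proof. by rewrite /bidegree_le rmorph1 size_poly1. Qed.

Lemma bidegree_leM D D' u v : bidegree_le D u -> bidegree_le D' v ->
  bidegree_le (D + D') (u * v).
Proof.
move=> /andP[u1 u2] /andP[v1 v2]; rewrite /bidegree_le rmorphM.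
have le (a b : nat) : (a <= D.+1 -> b <= D'.+1 -> (a + b).-1 <= (D + D').+1)%N.
  by lia.
by apply/andP; split; apply: leq_trans (size_polyMleq _ _) (le _ _ _ _).
Qed.

Lemma bidegree_leX D u n : bidegree_le D u -> bidegree_le (D * n) (u ^+ n).
Proof.
move=> uD; elim: n => [|n IH]; first by rewrite muln0 expr0 bidegree_le1.
by rewrite exprS mulnS bidegree_leM.
Qed.

Lemma bidegree_leW D D' u : (D <= D')%N -> bidegree_le D u -> bidegree_le D' u.
Proof.
move=> le /andP[u1 u2]; apply/andP.
by split; [apply: leq_trans u1 _|apply: leq_trans u2 _].
Qed.

(** Polynomials of bidegree at most D have (D + 1)^2 coefficients; a matrix with more rows than
    columns has a nonzero left kernel. *)
Lemma bidegree_lin_dep (I : finType) (D : nat) (e : I -> {poly {poly L}}) :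
  (forall i, bidegree_le D (e i)) -> (D.+1 * D.+1 < #|I|)%N ->
  exists c : I -> L, (exists i, c i != 0) /\ \sum_i (c i)%:P%:P * e i = 0.
Proof.
move=> eD lt_card; set K := D.+1.
pose C : 'M[L]_(#|I|, K * K) :=
  \matrix_(i < #|I|) mxvec (\matrix_(a < K, b < K) (e (enum_val i))`_a`_b).
have ker0 : kermx C != 0.
  rewrite -mxrank_eq0 mxrank_ker subn_eq0 -ltnNge.
  by apply: leq_ltn_trans (rank_leq_col _) _.
have /rowV0Pn[v /sub_kermxP vC v0] := ker0.
exists (fun i => v 0 (enum_rank i)); split.
  have /existsP[i vi] : [exists i, v 0 i != 0].
    apply: contraR v0 => /existsPn all0; apply/eqP/rowP => i.
    by rewrite mxE; apply/eqP; have := all0 i; rewrite negbK.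
  by exists (enum_val i); rewrite enum_valK.
apply/polyP => a; apply/polyP => b; rewrite !coef0 coef_sum coef_sum.
have [aK|Ka] := ltnP a K; last first.
  apply: big1 => i _; rewrite coefCM coefCM.
  case/andP: (eD i) => /leq_sizeP le _.
  by rewrite (le a Ka) coef0 mulr0.
have [bK|Kb] := ltnP b K; last first.
  apply: big1 => i _; rewrite coefCM coefCM.
  case/andP: (eD i) => _ /leq_sizeP le.
  by rewrite -coef_swapXY (le b Kb) coef0 mulr0.
have := congr1 (fun r : 'rV_(K * K) => r 0 (mxvec_index (Ordinal aK) (Ordinal bK))) vC.
rewrite !mxE => h; apply: etrans h; rewrite (reindex (@enum_val I predT)) /=; last first.
  exists (@enum_rank I) => i _; [exact: enum_valK | exact: enum_rankK].
apply: eq_bigr => i _; rewrite coefCM coefCM enum_valK !mxE mxvecE.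
by rewrite mxE.
Qed.

Lemma plane_trdeg u v w :
  exists (N : nat) (c : 'I_N * 'I_N * 'I_N -> L),
    (exists i, c i != 0) /\
    \sum_i (c i)%:P%:P * (u ^+ i.1.1 * v ^+ i.1.2 * w ^+ i.2) = 0.
Proof.
pose d (y : {poly {poly L}}) := (size y + size (swapXY y))%N.
pose D := (d u + d v + d w)%N.
have bD y : (d y <= D)%N -> bidegree_le D y.
  move=> le; apply/andP; split; apply: leqW; apply: leq_trans le.
    exact: leq_addr.
  exact: leq_addl.
have uD : bidegree_le D u by apply: bD; rewrite /D -addnA leq_addr.
have vD : bidegree_le D v by apply: bD; rewrite /D addnAC leq_addl.
have wD : bidegree_le D w by apply: bD; rewrite /D leq_addl.
(* The N^3 products with exponents below N have bidegree at most 3 D N, and (3 D N + 1)^2 <= N^2 (3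
   D + 1)^2 < N^3 for this N. *)
pose N := (((3 * D).+1 ^ 2).+1)%N; exists N.
have [i||c [c0 cE]] := @bidegree_lin_dep _ (N * (3 * D))
    (fun i : 'I_N * 'I_N * 'I_N => u ^+ i.1.1 * v ^+ i.1.2 * w ^+ i.2).
- apply: bidegree_leW (bidegree_leM (bidegree_leM (bidegree_leX i.1.1 uD)
    (bidegree_leX i.1.2 vD)) (bidegree_leX i.2 wD)).
  have [] : (i.1.1 < N /\ i.1.2 < N /\ i.2 < N)%N by rewrite !ltn_ord.
  move: (i.1.1 : nat) (i.1.2 : nat) (i.2 : nat) => n1 n2 n3 l1 [l2 l3].
  by rewrite -!mulnDr mulnC mulnA leq_mul2r; apply/orP; right; lia.
- rewrite !card_prod card_ord.
  have le : ((N * (3 * D)).+1 <= N * (3 * D).+1)%N by rewrite mulnS; lia.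
  apply: leq_ltn_trans (leq_mul le le) _.
  rewrite mulnACA ltn_mul2l muln_gt0 /=.
  by rewrite /N -mulnn ltnS.
by exists c.
Qed.
End Counting.

(** * Invariants of an exponential map on a form of the plane *)

Section UFDTheory.
Variable R : comNzRingType.
Hypothesis ufdR : is_ufd R.

Let domR : GRing.integral_domain_axiom R. Proof. by case: ufdR. Qed.

Lemma invertible_factor (x y : R) : invertible (x * y) -> invertible x.
Proof. by case=> z e; exists (y * z); rewrite mulrA. Qed.

Lemma ufd_factors (x : R) : x != 0 -> ~ invertible x ->
  exists2 s : seq R, (forall p, p \in s -> irreducible_elt p)
    & x = \prod_(p <- s) p.
Proof. by case: ufdR => _ + _; apply. Qed.

Lemma irreducible_associated_dvd (p q : R) : associated p q ->
  exists r, q = p * r.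
Proof. by case=> u _ ->; exists u; rewrite mulrC. Qed.

Lemma prod_dvd (s : seq R) x : x \in s -> exists r, \prod_(p <- s) p = x * r.
Proof.
move=> xs; exists (\prod_(p <- rem x s) p).
by rewrite (perm_big _ (perm_to_rem xs)) big_cons.
Qed.

Lemma ufd_prime (p a b c : R) : irreducible_elt p -> a * b = p * c ->
  (exists a', a = p * a') \/ (exists b', b = p * b').
Proof.
move=> irr_p abE; have [p0 pU irr] := irr_p.
have [a0|a0] := eqVneq a 0; first by left; exists 0; rewrite mulr0.
have [b0|b0] := eqVneq b 0; first by right; exists 0; rewrite mulr0.
have [[a' aU]|aU] := boolp.EM (invertible a).
  by right; exists (a' * c); rewrite mulrCA -abE mulrA [a' * a]mulrC aU mul1r.
have [[b' bU]|bU] := boolp.EM (invertible b).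
  by left; exists (b' * c); rewrite mulrCA -abE mulrCA [b' * b]mulrC bU mulr1.
have [s irr_s sE] := ufd_factors a0 aU.
have [t irr_t tE] := ufd_factors b0 bU.
have st_irr q : q \in s ++ t -> irreducible_elt q.
  by rewrite mem_cat => /orP[/irr_s|/irr_t].
(* The head [q] of a factorization of a b is a multiple of [p]; uniqueness associates it with a
   factor of [a] or of [b]. It is used with q = p, or with q = p c when [c] is a unit. *)
have fin (q r : R) (u : seq R) : (forall x, x \in q :: u -> irreducible_elt x) ->
    \prod_(x <- q :: u) x = \prod_(x <- s ++ t) x -> q = p * r -> 
  (exists a', a = p * a') \/ (exists b', b = p * b').
  move=> irr_u uE qE; have [_ _ uniq] := ufdR.
  have [v [v_st sz v_as]] := uniq _ _ irr_u st_irr uE.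
  have v0 : v`_0 \in s ++ t by rewrite -(perm_mem v_st) mem_nth // -sz.
  have [d vE] := irreducible_associated_dvd (v_as 0%N isT).
  have {}vE : v`_0 = p * (r * d) by rewrite vE /= qE mulrA.
  move: v0; rewrite mem_cat => /orP[/prod_dvd|/prod_dvd] [e eE].
    by left; exists (r * d * e); rewrite sE eE vE !mulrA.
  by right; exists (r * d * e); rewrite tE eE vE !mulrA.
have c0 : c != 0.
  by apply: contraNneq (domM_neq0 domR a0 b0) => c0; rewrite abE c0 mulr0.
have [[c' cU]|cU] := boolp.EM (invertible c).
  apply: (fin (p * c) c [::]) => //; last first.
    by rewrite big_seq1 big_cat /= -sE -tE.
  move=> x; rewrite inE => /eqP ->; split=> [|/invertible_factor //|x' y' e].
    exact: domM_neq0.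
  have := irr x' (y' * c'); rewrite mulrA -e -mulrA cU mulr1.
  by case=> // [|/invertible_factor]; [left|right].
have [u irr_u uE] := ufd_factors c0 cU.
apply: (fin p 1 u); rewrite ?mulr1 //.
  by move=> x; rewrite inE => /orP[/eqP -> //|/irr_u].
by rewrite big_cons -uE -abE big_cat /= -sE -tE.
Qed.

End UFDTheory.

(** * Descent of linear dependence from M to k *)

Section BaseChangeTheory.
Variables (k M : fieldType) (s : {rmorphism k -> M}) (A : comAlgType k).
Variable j : {rmorphism A -> {poly {poly M}}}.
Hypothesis jP : base_change_plane s j.

Lemma base_change_inj a : j a = 0 -> a = 0.
Proof.
move=> ja; apply: boolp.contrapT => a0; case: jP => _ _ sep.
have sW : subspace (fun a : A => a = 0).
  by split=> // c u v -> ->; rewrite scaler0 addr0.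
have [l [l_lin _]] := sep _ a sW a0.
by rewrite ja (plane_form0 l_lin) => /eqP; rewrite eq_sym oner_eq0.
Qed.

(** If [e i0] is not in the k-span of the other vectors, a functional vanishing on them and equal to
    1 at [e i0] sends the given relation to c i0 = 0. *)
Lemma base_change_lin_dep (I : finType) (e : I -> A) (c : I -> M) :
  (exists i, c i != 0) -> \sum_i (c i)%:P%:P * j (e i) = 0 ->
  exists d : I -> k, (exists i, d i != 0) /\ \sum_i d i *: e i = 0.
Proof.
case=> i0 ci0 sum0; case: jP => _ _ sep.
pose W a := exists2 d : I -> k, d i0 = 0 & a = \sum_i d i *: e i.
have sW : subspace W.
  split; first by exists (fun=> 0) => //; rewrite big1 // => i _; rewrite scale0r.
  move=> t _ _ [d d0 ->] [d' d'0 ->]; exists (fun i => t * d i + d' i).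
    by rewrite d0 d'0 mulr0 addr0.
  rewrite scaler_sumr -big_split; apply: eq_bigr => i _.
  by rewrite /= scalerDl scalerA.
have [[d d0 dE]|nW] := boolp.EM (W (e i0)).
  exists (fun i => (i == i0)%:R - d i); split.
    by exists i0; rewrite eqxx d0 subr0 oner_eq0.
  under eq_bigr => i _ do rewrite scalerBl.
  rewrite sumrB -dE (bigD1 i0) //= eqxx scale1r big1 ?addr0 ?subrr // => i /negPf->.
  by rewrite scale0r.
have [l [l_lin lW le]] := sep W (e i0) sW nW.
case/eqP: ci0; have := congr1 l sum0; rewrite (plane_form0 l_lin) (plane_form_sum l_lin).
rewrite (bigD1 i0) //= (plane_formM l_lin) le mulr1 big1 ?addr0 // => i ii0.
rewrite (plane_formM l_lin) lW ?mulr0 //; exists (fun i' => (i' == i)%:R).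
  by rewrite eq_sym (negPf ii0).
rewrite (bigD1 i) //= eqxx scale1r big1 ?addr0 // => i' /negPf->.
by rewrite scale0r.
Qed.

Lemma base_change_nonconst f m : (forall c, f <> c%:A) -> j f != m%:P%:P.
Proof.
move=> fnc; apply/eqP => jf.
have [||d [[i di]]] := @base_change_lin_dep bool
  (fun b => if b then 1 else f) (fun b => if b then m else - 1).
- by exists false; rewrite oppr_eq0 oner_eq0.
- by rewrite big_bool /= rmorph1 mulr1 jf !polyCN polyC1 mulN1r subrr.
rewrite big_bool /= => e; have [d0|d0] := eqVneq (d false) 0; last first.
  apply: (fnc (- (d true / d false))).
  apply: (@scalerI _ _ _ d0); rewrite scalerA mulrN mulrCA mulfV // mulr1.
  by apply/eqP; rewrite scaleNr -addr_eq0 addrC e.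
move: e; rewrite d0 scale0r addr0 => e.
case: i di; rewrite ?d0 ?eqxx // => dt.
apply: (fnc 0); rewrite scale0r.
have one0 : 1 = 0 :> A by apply: (@scalerI _ _ _ dt); rewrite e scaler0.
by rewrite -[f]mulr1 one0 mulr0.
Qed.

End BaseChangeTheory.

(** If [y] has Y-degree 0, so has every p(y), and Y is missed. Otherwise p(y) has Y-degree 0 only
    for constant p, and X is missed. *)
Lemma plane_not_monogenic (L : fieldType) (y : {poly {poly L}}) :
  ~ forall w, exists p : {poly L}, w = (map_poly (polyC \o polyC) p).[y].
Proof.
move=> gen.
have comp p : (map_poly (polyC \o polyC) p).[y] = map_poly polyC p \Po y.
  by rewrite /comp_poly -map_poly_comp.
have [yc|ync] := leqP (size y) 1.
  have [p] := gen 'X; rewrite comp => /(congr1 (fun q : {poly {poly L}} => size q)).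
  rewrite size_polyX (size1_polyC yc) comp_polyCr => /eqP.
  by rewrite eqn_leq ltnNge size_polyC leq_b1.
have [p] := gen 'X%:P; rewrite comp => pE.
have := size_comp_poly (map_poly polyC p) y; rewrite -pE size_polyC polyX_eq0 /=.
rewrite size_map_polyC => -[/esym/eqP]; rewrite muln_eq0.
have -> : ((size y).-1 == 0)%N = false by case: (size y) ync => [|[]].
rewrite orbF => /eqP sp.
have [c pc] : exists c, p = c%:P.
  by exists p`_0; apply: size1_polyC; case: (size p) sp => [|[]].
move: pE; rewrite pc map_polyC comp_polyC.
move/polyC_inj/(congr1 (fun q : {poly L} => size q)).
rewrite size_polyX => /eqP.
by rewrite eqn_leq ltnNge size_polyC leq_b1.
Qed.

(** * The ring of invariants is k[f] *)

Section Invariants.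
Variables (k L : fieldType) (iota : {rmorphism k -> L}) (A : comAlgType k).
Variables (phi : {rmorphism A -> {poly A}}) (eps : {lrmorphism A -> k^o}).
Variable j : {rmorphism A -> {poly {poly L}}}.
Hypothesis ufdA : is_ufd A.
Hypothesis phi0 : forall a, (phi a).[0] = a.
Hypothesis phiD : forall a, map_poly phi (phi a) = poly_XaY (phi a).
Hypothesis phik : forall c : k, fixed phi c%:A.
Hypothesis nontriv : ~ (forall a, phi a = a%:P).
Hypothesis jP : base_change_plane iota j.

Let domA : GRing.integral_domain_axiom A. Proof. by case: ufdA. Qed.

(** The outer variable goes to [u] and the inner one to [v], so [eval2 x f] evaluates at x a
    polynomial with coefficients in k[f]. *)
Definition eval2 (u v : A) (H : {poly {poly k}}) : A :=
  (map_poly (horner_alg v) H).[u].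
HB.instance Definition _ u v := GRing.RMorphism.copy (eval2 u v) 
  (horner_eval u \o map_poly (horner_alg v)).

Lemma fixedZ c a : fixed phi a -> fixed phi (c *: a).
Proof. by move=> ia; rewrite -mulr_algl; apply: fixedM. Qed.

(** The three elements b1, b2 and a slice x are dependent over L inside L[X, Y], hence over k. As x
    is transcendental over the invariants, the coefficient of each power of x vanishes; one of these
    is a nontrivial relation between b1 and b2. *)
Lemma inv_alg_dep b1 b2 : fixed phi b1 -> fixed phi b2 ->
  exists2 H, H != 0 & eval2 b1 b2 H = 0.
Proof.
move=> ib1 ib2; have [n [x slx]] := slice_ex phi0 nontriv.
have [N [c [c0 cE]]] := plane_trdeg (j b1) (j b2) (j x).
have [|d [[i0 di0] dE]] := base_change_lin_dep jP
  (e := fun i : 'I_N * 'I_N * 'I_N => b1 ^+ i.1.1 * b2 ^+ i.1.2 * x ^+ i.2) c0.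
  by rewrite -[RHS]cE; apply: eq_bigr => i _; rewrite !rmorphM !rmorphXn.
pose P : {poly A} := \sum_i (d i *: (b1 ^+ i.1.1 * b2 ^+ i.1.2))%:P * 'X^(i.2).
have Pi l : fixed phi P`_l.
  rewrite coef_sum; elim/big_ind: _ => [|u v|i _]; first exact: fixed0.
    exact: fixedD.
  rewrite coefCM coefXn; apply: fixedM; last first.
    by case: eqP => _; [apply: fixed1|apply: fixed0].
  by apply: fixedZ; apply: fixedM; apply: fixedX.
have Px : P.[x] = 0.
  rewrite -dE /P horner_sum; apply: eq_bigr => i _.
  by rewrite hornerM hornerC hornerXn -scalerAl.
have P0 := slice_transcendental domA slx Pi Px.
pose H : {poly {poly k}} :=
  \sum_(i | i.2 == i0.2) (d i *: 'X^(i.1.2))%:P * 'X^(i.1.1).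
exists H.
  apply/eqP => H0; case/eqP: di0.
  have := congr1 (fun q : {poly {poly k}} => q`_(i0.1.1)`_(i0.1.2)) H0.
  rewrite !coef0 !coef_sum (bigD1 i0) //= coefCM coefXn eqxx mulr1 coefZ coefXn.
  rewrite eqxx mulr1 big1 ?addr0 // => -[[i1 i2] i3] /= /andP[/eqP -> ne].
  rewrite coefCM coefXn; case: eqP => [e1|_]; last by rewrite mulr0 coef0.
  rewrite mulr1 coefZ coefXn; case: eqP => [e2|_]; last by rewrite mulr0.
  case/eqP: ne; rewrite -(ord_inj e1) -(ord_inj e2).
  by case: (i0) => -[].
have := congr1 (fun q : {poly A} => q`_(i0.2)) P0; rewrite coef0 coef_sum => <-.
rewrite /eval2 rmorph_sum horner_sum [RHS](bigID (fun i => i.2 == i0.2)) /=.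
rewrite [X in _ + X]big1 ?addr0 => [|i /negPf ne]; last first.
  by rewrite coefCM coefXn eq_sym val_eqE ne mulr0.
apply: eq_bigr => i /eqP ->; rewrite coefCM coefXn eqxx mulr1.
rewrite rmorphM /= map_polyC /= map_polyXn hornerM hornerC hornerXn.
by rewrite linearZ /= rmorphXn /= horner_algX -scalerAl mulrC mul1r -scalerAr.
Qed.
Lemma alg_poly_eval (x : A) (P : {poly A}) :
  (forall i, exists c : k, P`_i = c%:A) -> exists p, P.[x] = horner_alg x p.
Proof.
move=> Pc; have [p pE] : exists p, P = map_poly (in_alg A) p.
  have [f fE] : exists f : nat -> k, forall i, P`_i = (f i)%:A.
    by exists (fun i => sval (boolp.cid (Pc i))) => i; case: boolp.cid.
  exists (\poly_(i < size P) f i); apply/polyP => i.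
  rewrite coef_map coef_poly; case: ltnP => [_|le]; first exact: fE.
  by rewrite nth_default //= scale0r.
by exists p; rewrite pE.
Qed.

(** If all invariants were constants, the leading coefficient of a slice x would be invertible, so A
    = k[x] and L[X, Y] would be generated by one element. *)
Lemma exists_fixed_nonconst : exists2 b, fixed phi b & forall c : k, b <> c%:A.
Proof.
apply: boolp.contrapT => none.
have allc b : fixed phi b -> exists c : k, b = c%:A.
  move=> ib; apply: boolp.contrapT => nc; apply: none; exists b => // c bc.
  by apply: nc; exists c.
have [n [x slx]] := slice_ex phi0 nontriv.
have gen a : exists p, a = horner_alg x p.
  have [N [P Pi PE]] := slice_cover domA phi0 phiD slx a.
  have [p pE] := alg_poly_eval x (fun i => allc _ (Pi i)).
  have [d dE] := allc _ (slice_lead_inv phiD slx).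
  have d0 : d != 0.
    by apply: contraNneq (slice_lead_neq0 slx) => d0; rewrite dE d0 scale0r.
  exists (d ^- N *: p); rewrite linearZ /= -pE -PE dE exprZn expr1n.
  by rewrite !mulr_algl scalerA mulVf ?scale1r // expf_neq0.
apply: (@plane_not_monogenic L (j x)) => w.
case: jP => jZ jS _; have [r ->] := jS w.
elim: r => [|[m a] r [p pE]]; first by exists 0; rewrite big_nil rmorph0 horner0.
rewrite big_cons pE /=; have [q ->] := gen a.
exists (m *: map_poly iota q + p); rewrite rmorphD hornerD; congr (_ + _).
rewrite -mul_polyC rmorphM hornerM /= map_polyC hornerC; congr (_ * _).
rewrite /horner_alg /horner_morph -horner_map -!map_poly_comp; congr (_.[_]).
by apply: eq_map_poly => c /=; rewrite jZ rmorph1 mulr1.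
Qed.

Lemma retraction_alg (c : k) : eps c%:A = c.
Proof. by rewrite linearZ /= rmorph1 /GRing.scale /= mulr1. Qed.

(** For a nonconstant invariant b, the element b - eps(b) is a nonunit because [eps] kills it. So
    [eps] kills one of its irreducible factors, which is invariant by factorial closedness. *)
Lemma exists_fixed_irreducible :
  exists f, [/\ irreducible_elt f, fixed phi f & eps f = 0].
Proof.
have [b ib bnc] := exists_fixed_nonconst.
pose b' := b - (eps b)%:A.
have eps1 : eps 1 = 1 by exact: rmorph1.
have epsb' : eps b' = 0.
  by rewrite /b' raddfB /= (retraction_alg (eps b)) subrr.
have b'0 : b' != 0.
  by apply/eqP => /eqP; rewrite subr_eq0 => /eqP; apply: bnc.
have b'U : ~ invertible b'.
  case=> c /(congr1 eps); rewrite rmorphM /= eps1 epsb' mul0r => /eqP.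
  by rewrite eq_sym oner_eq0.
have ib' : fixed phi b' by apply: fixedD => //; apply: fixedN; apply: phik.
have [s irr_s sE] := ufd_factors ufdA b'0 b'U.
have [f fs epsf] : exists2 f, f \in s & eps f = 0.
  have : \prod_(p <- s) (eps p : k) = 0 by rewrite -epsb' sE rmorph_prod.
  move/eqP; rewrite prodf_seq_eq0 => /hasP[f fs /eqP f0]; by exists f.
exists f; split=> //; first exact: irr_s.
have [r rE] := prod_dvd fs; rewrite -sE in rE.
by apply: (fixed_factor domA phi0 (b := r)); rewrite -rE.
Qed.

Section Generator.
Variable f : A.
Hypotheses (irr_f : irreducible_elt f) (if_ : fixed phi f) (epsf : eps f = 0).

Lemma eps_horner_alg g p : eps (horner_alg g p) = p.[eps g].
Proof.
rewrite /horner_alg /horner_morph -horner_map -map_poly_comp.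
rewrite (_ : map_poly _ p = p) //; apply: map_poly_id => c _ /=.
exact: retraction_alg.
Qed.

Lemma dvd_horner_alg g h r : eps g = 0 -> h != 0 -> horner_alg g h = f * r ->
  exists r', g = f * r'.
Proof.
move=> epsg; elim/poly_ind: h r => [|h c IH] r; first by rewrite eqxx.
move=> h0 hE; have c0 : c = 0.
  have := eps_horner_alg g (h * 'X + c%:P).
  by rewrite hE rmorphM /= epsf mul0r epsg hornerD hornerMX mulr0 hornerC add0r.
move: h0 hE; rewrite c0 addr0 mulf_eq0 polyX_eq0 orbF => h0.
rewrite rmorphM /= horner_algX; case/(ufd_prime ufdA irr_f) => [[a]|//].
exact: IH.
Qed.

(** In a relation H(f, g) = 0, powers of f are cancelled until the term free of f is a nonzero q(g);
    then f divides q(g). *)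
Lemma fixed_dvd g : fixed phi g -> eps g = 0 -> exists r, g = f * r.
Proof.
move=> ig epsg; have [H H0 HE] := inv_alg_dep if_ ig.
elim/poly_ind: H H0 HE => [|H q IH]; first by rewrite eqxx.
have [->|q0] := eqVneq q 0.
  rewrite addr0 mulf_eq0 polyX_eq0 orbF => H0; rewrite /eval2 rmorphM /= map_polyX.
  rewrite hornerMX => /domA/orP[/eqP|/eqP f0]; first exact: IH.
  by case: irr_f; rewrite f0 eqxx.
move=> _; rewrite /eval2 rmorphD rmorphM /= map_polyX map_polyC hornerD hornerMX hornerC.
move/eqP; rewrite addrC addr_eq0 mulrC -mulrN => /eqP.
exact: dvd_horner_alg.
Qed.

Lemma fixed_generated b : fixed phi b -> exists p, b = horner_alg f p.
Proof.
(* For nonzero w this is deg_X w + deg_Y w + 2. As [j f] is not constant, passing from g = f r to r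
   - eps(r) lowers it, even though no grading of A itself is at hand. *)
pose mu (w : {poly {poly L}}) := (size w + size (swapXY w))%N.
have muf : (2 < mu (j f))%N.
  rewrite ltnNge; apply/negP => le.
  have jf0 : j f != 0.
    by apply/eqP => /(base_change_inj jP) f0; case: irr_f; rewrite f0 eqxx.
  have le1 : (size (j f) <= 1)%N.
    have : (0 < size (swapXY (j f)))%N by rewrite size_poly_gt0 swapXY_eq0.
    by move: le; rewrite /mu; lia.
  have le2 : (size (swapXY (j f)) <= 1)%N.
    have : (0 < size (j f))%N by rewrite size_poly_gt0.
    by move: le; rewrite /mu; lia.
  have /eqP[] : j f != ((j f)`_0`_0)%:P%:P; last first.
    rewrite [LHS]size1_polyC //; congr _%:P; apply: size1_polyC.
    by rewrite (leq_trans (max_size_coefXY _ _)) // sizeYE.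
  apply: (base_change_nonconst jP) => c fc.
  move: epsf; rewrite fc retraction_alg => c0.
  by case: irr_f; rewrite fc c0 scale0r eqxx.
have muM u v : u != 0 -> v != 0 -> (mu (u * v)%R + 2 = mu u + mu v)%N.
  move=> u0 v0; rewrite /mu rmorphM /= !size_mul ?swapXY_eq0 //.
  have arith (a a' c c' : nat) : (0 < a -> 0 < a' ->
      (a + c).-1 + (a' + c').-1 + 2 = (a + a') + (c + c'))%N by lia.
  by apply: arith; rewrite size_poly_gt0 ?swapXY_eq0.
have muC u c : u != 0 -> (mu (u - c%:P%:P)%R <= mu u)%N.
  move=> u0; have swE : swapXY (u - c%:P%:P) = swapXY u - c%:P%:P.
    by rewrite raddfB; congr (_ - _); rewrite /= swapXY_polyC map_polyC.
  rewrite /mu swE.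
  have le (v : {poly {poly L}}) : v != 0 -> (size (v - c%:P%:P)%R <= size v)%N.
    rewrite -size_poly_gt0 => v0; apply: leq_trans (size_polyD _ _) _.
    rewrite size_polyN geq_max leqnn /=.
    by apply: leq_trans v0; rewrite size_polyC leq_b1.
  by rewrite leq_add // le // swapXY_eq0.
have jk (c : k) : j c%:A = (iota c)%:P%:P.
  by case: jP => jZ _ _; rewrite jZ rmorph1 mulr1.
have main n g : (mu (j g) < n)%N -> fixed phi g -> eps g = 0 ->
    exists p, g = horner_alg f p.
  elim: n g => // n IH g; rewrite ltnS => le_n ig epsg.
  have [->|g0] := eqVneq g 0; first by exists 0; rewrite rmorph0.
  have [r gE] := fixed_dvd ig epsg.
  have f0 : f != 0 by case: irr_f.
  have r0 : r != 0 by apply: contraNneq g0 => r0; rewrite gE r0 mulr0.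
  have ir : fixed phi r by apply: (fixed_factor_l domA phi0 f0 if_); rewrite -gE.
  have j0 a : a != 0 -> j a != 0.
    by apply: contraNneq => /(base_change_inj jP) ->.
  have [|||q qE] := IH (r - (eps r : k)%:A).
  - rewrite rmorphB /= jk; apply: leq_ltn_trans (muC _ _ (j0 _ r0)) _.
    have := muM _ _ (j0 _ f0) (j0 _ r0); rewrite -rmorphM -gE.
    have arith (x y z : nat) : (2 < y -> x <= n -> x + 2 = y + z -> z < n)%N by lia.
    exact: arith.
  - by apply: fixedD => //; apply: fixedN; apply: phik.
  - by rewrite raddfB /= (retraction_alg (eps r)) subrr.
  exists ('X * (q + (eps r : k)%:P)).
  rewrite rmorphM rmorphD /= horner_algX -qE horner_algC subrK.
  by rewrite gE.
move=> ib; have [||p pE] := main _ (b - (eps b : k)%:A) (leqnn _).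
- by apply: fixedD => //; apply: fixedN; apply: phik.
- by rewrite raddfB /= (retraction_alg (eps b)) subrr.
by exists (p + (eps b : k)%:P); rewrite rmorphD /= -pE horner_algC subrK.
Qed.

End Generator.
End Invariants.

(** * Fibers of f over extensions *)

Lemma polyC_factor (R : idomainType) (u v : {poly R}) c : c != 0 ->
  u * v = c%:P -> exists u0 v0, [/\ u = u0%:P, v = v0%:P & u0 * v0 = c].
Proof.
move=> c0 e; have : u * v != 0 by rewrite e polyC_eq0.
rewrite mulf_eq0 negb_or => /andP[u0 v0].
have := size_mul u0 v0; rewrite e size_polyC c0 => sz.
have [su sv] : (size u <= 1)%N /\ (size v <= 1)%N.
  by move: sz u0 v0; rewrite -!size_poly_gt0; lia.
exists u`_0, v`_0; split; [exact: size1_polyC|exact: size1_polyC|].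
apply: polyC_inj; rewrite -e {2}(size1_polyC su) {2}(size1_polyC sv).
by rewrite polyCM.
Qed.

Lemma plane_constant_factor (M : fieldType) (u v : {poly {poly M}}) c : c != 0 ->
  u * v = c%:P%:P -> exists u0, u = u0%:P%:P.
Proof.
move=> c0; case/polyC_factor; first by rewrite polyC_eq0.
move=> u0 [v0 [-> _ /polyC_factor[//|u1 [v1 [-> _ _]]]]].
by exists u1.
Qed.

Section Adjoin.
Variables (k : fieldType) (U : lmodType k) (W : U -> Prop).

(** The sum of [W] and the span of [l], in recursive form so that inductions peel off one vector at
    a time. *)
Fixpoint adjoin (l : seq U) (w : U) : Prop :=
  if l is a :: l' then exists t w', adjoin l' w' /\ w = t *: a + w' else W w.

Lemma adjoin_subspace l : subspace W -> subspace (adjoin l).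
Proof.
move=> sW; elim: l => //= a l [IH0 IH]; split.
  by exists 0, 0; rewrite scale0r addr0.
move=> c _ _ [t [w [Ww ->]]] [t' [w' [Ww' ->]]].
exists (c * t + t'), (c *: w + w'); split; first exact: IH.
by rewrite scalerDr scalerDl scalerA addrACA.
Qed.

Lemma adjoin_base l w : W w -> adjoin l w.
Proof.
by elim: l w => //= a l IH w Ww; exists 0, w; rewrite scale0r add0r; split; [apply: IH|].
Qed.

Lemma adjoin_mem (l : seq U) a : W 0 -> a \in l -> adjoin l a.
Proof.
move=> W0; elim: l => //= b l IH; rewrite inE => /orP[/eqP->|/IH al].
  by exists 1, 0; rewrite scale1r addr0; split=> //; apply: adjoin_base.
by exists 0, a; rewrite scale0r add0r.
Qed.
End Adjoin.

Section Key.
Variables (k M : fieldType) (s : {rmorphism k -> M}) (A : comAlgType k).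
Variable j : {rmorphism A -> {poly {poly M}}}.
Variables f x : A.
Hypothesis jP : base_change_plane s j.
Hypothesis indep : forall P, eval2 x f P = 0 -> P = 0.
Hypothesis cover : forall a, exists2 r, r != 0 &
  exists P, horner_alg f r * a = eval2 x f P.
Hypothesis factor : forall r a q, r != 0 -> horner_alg f r * a = horner_alg f q ->
  exists q', a = horner_alg f q'.

Let jZ c a : j (c *: a) = (s c)%:P%:P * j a. Proof. by case: jP. Qed.

Definition evalf : {poly M} -> {poly {poly M}} :=
  horner_eval (j f) \o map_poly (polyC \o polyC).
HB.instance Definition _ := GRing.RMorphism.on evalf.

Definition evalfx : {poly {poly M}} -> {poly {poly M}} :=
  horner_eval (j x) \o map_poly evalf.
HB.instance Definition _ := GRing.RMorphism.on evalfx.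

Lemma evalfC c : evalf c%:P = c%:P%:P.
Proof. by rewrite /evalf /= map_polyC /= /horner_eval hornerC. Qed.
Lemma evalfX : evalf 'X = j f.
Proof. by rewrite /evalf /= map_polyX /= /horner_eval hornerX. Qed.
Lemma evalfxC q : evalfx q%:P = evalf q.
Proof. by rewrite /evalfx /= map_polyC /= /horner_eval hornerC. Qed.
Lemma evalfxX : evalfx 'X = j x.
Proof. by rewrite /evalfx /= map_polyX /= /horner_eval hornerX. Qed.

Lemma evalfE (n : nat) (q : {poly M}) : (size q <= n)%N ->
  evalf q = \sum_(i < n) (q`_i)%:P%:P * j (f ^+ i).
Proof.
move=> le; rewrite /evalf /= /horner_eval (@horner_coef_wide _ n); last first.
  by rewrite (leq_trans (size_poly _ _)).
by apply: eq_bigr => i _; rewrite coef_map rmorphXn.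
Qed.

Lemma j_horner_alg q : j (horner_alg f q) = evalf (map_poly s q).
Proof.
rewrite /evalf /= /horner_eval /horner_alg /horner_morph -horner_map.
rewrite -!map_poly_comp; congr (_.[_]); apply: eq_map_poly => c /=.
by rewrite jZ rmorph1 mulr1.
Qed.

Lemma j_eval2 P : j (eval2 x f P) = evalfx (map_poly (map_poly s) P).
Proof.
rewrite /evalfx /= /horner_eval /eval2 -horner_map -!map_poly_comp.
by congr (_.[_]); apply: eq_map_poly => q /=; rewrite j_horner_alg.
Qed.

(** A relation between f and x over M is a linear dependence of the monomials f^i x^j, which
    descends to k and contradicts [indep]. *)
Lemma evalfx_inj P : evalfx P = 0 -> P = 0.
Proof.
move=> e; apply: boolp.contrapT => /eqP P0.
pose I := ('I_(size P) * 'I_(sizeY P))%type.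
have [|| d [[i0 di0] dE]] := base_change_lin_dep jP (I := I)
   (e := fun i => f ^+ i.2 * x ^+ i.1) (c := fun i => P`_(i.1)`_(i.2)).
- have lP : lead_coef P != 0 by rewrite lead_coef_eq0.
  have i1 : ((size P).-1 < size P)%N by rewrite prednK // size_poly_gt0.
  have i2 : ((size (lead_coef P)).-1 < sizeY P)%N.
    by rewrite (leq_trans _ (max_size_lead_coefXY P)) // prednK // size_poly_gt0.
  by exists (Ordinal i1, Ordinal i2); rewrite /= -!lead_coefE lead_coef_eq0.
- rewrite -[RHS]e /evalfx /= /horner_eval (@horner_coef_wide _ (size P)) ?size_poly //.
  rewrite -(pair_bigA _ (fun (i1 : 'I_(size P)) (i2 : 'I_(sizeY P)) =>
    (P`_i1`_i2)%:P%:P * j (f ^+ i2 * x ^+ i1))) /=.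
  apply: eq_bigr => i _; rewrite coef_map /= (evalfE (max_size_coefXY P i)).
  rewrite mulr_suml; apply: eq_bigr => i' _.
  by rewrite rmorphM /= [j (x ^+ i)]rmorphXn mulrA.
pose H : {poly {poly k}} := \sum_(i : I) (d i *: 'X^(i.2))%:P * 'X^(i.1).
have H0 : H = 0.
  apply: indep; rewrite -dE /eval2 rmorph_sum horner_sum; apply: eq_bigr => i _.
  rewrite rmorphM /= map_polyC /= map_polyXn hornerM hornerC hornerXn.
  by rewrite linearZ /= rmorphXn /= horner_algX mulr_algl -scalerAl.
case/eqP: di0; have := congr1 (fun q : {poly {poly k}} => q`_(i0.1)`_(i0.2)) H0.
rewrite !coef0 !coef_sum (bigD1 i0) //= coefCM coefXn eqxx mulr1 coefZ coefXn.
rewrite eqxx mulr1 big1 ?addr0 // => -[i1 i2] /= ne.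
rewrite coefCM coefXn; case: eqP => [e1|_]; last by rewrite mulr0 coef0.
rewrite mulr1 coefZ coefXn; case: eqP => [e2|_]; last by rewrite mulr0.
by case/eqP: ne; rewrite -(ord_inj e1) -(ord_inj e2); case: (i0).
Qed.
Lemma evalf_inj q : evalf q = 0 -> q = 0.
Proof. by rewrite -evalfxC => /evalfx_inj/eqP; rewrite polyC_eq0 => /eqP. Qed.

(** Only finitely many elements of A occur in [u], so the denominator can be kept over k, as
    [evalf_factor] requires. *)
Lemma cover_plane u : exists2 r, r != 0 &
  exists P, evalf (map_poly s r) * u = evalfx P.
Proof.
case: jP => _ jS _; have [l ->] := jS u.
elim: l => [|[m a] l [r2 r20 [P2 P2E]]].
  by exists 1; rewrite ?oner_eq0 //; exists 0; rewrite big_nil mulr0 rmorph0.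
have [r1 r10 [P1 P1E]] := cover a.
exists (r1 * r2); first exact: mulf_neq0.
exists ((m%:P * map_poly s r2)%:P * map_poly (map_poly s) P1 + (map_poly s r1)%:P * P2).
rewrite rmorphD !rmorphM /= -P2E -j_eval2 -P1E rmorphM j_horner_alg !evalfxC.
by rewrite big_cons /= evalfC; ring.
Qed.

Let B a := exists q, a = horner_alg f q.

Let sB : subspace B.
Proof.
split; first by exists 0; rewrite rmorph0.
move=> c _ _ [q ->] [q' ->]; exists (c *: q + q').
by rewrite rmorphD /= linearZ /= mulr_algl.
Qed.

Let comb (l : seq (M * A)) := \sum_(q <- l) q.1%:P%:P * j q.2.

(** Here a' is a k-combination of the vectors in [l], so adding m (x) a' to [comb l] changes its
    coefficients but not its length. *)
Lemma adjoin_shift S (l : seq (M * A)) w : adjoin B [seq S * q.2 | q <- l] w ->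
  exists a' b, [/\ B b, w = S * a' + b
    & forall m, exists2 l', size l' = size l & comb l' = comb l + m%:P%:P * j a'].
Proof.
elim: l w => [|q l IH] w /=.
  move=> Bw; exists 0, w; rewrite mulr0 add0r; split=> // m; exists [::] => //.
  by rewrite rmorph0 mulr0 addr0.
case=> t [w' [/IH[a' [b [Bb -> lE]]] ->]].
exists (t *: q.2 + a'), b; split=> //; first by rewrite mulrDr scalerAr addrA.
move=> m; have [l' sl' l'E] := lE m.
exists ((q.1 + m * s t, q.2) :: l'); first by rewrite /= sl'.
rewrite /comb !big_cons /= -!/(comb _) l'E (rmorphD j) jZ !polyCD !polyCM; ring.
Qed.

(** The hypothesis [factor] carried to M, by induction on the number of terms m (x) a of [u]: the
    first term is either rewritten through the others modulo M[f], or shown to have coefficient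
    0. *)
Lemma evalf_factor (r : {poly k}) (u : {poly {poly M}}) (q : {poly M}) : r != 0 ->
  evalf (map_poly s r) * u = evalf q -> exists u0, u = evalf u0.
Proof.
move=> r0; case: jP => _ jS sep; have [l ->] := jS u; rewrite -/(comb l).
pose S := horner_alg f r.
have [n] := ubnP (size l); elim: n l q => // n IH [|[m a] l] q.
  by move=> _ _; exists 0; rewrite /comb big_nil rmorph0.
rewrite ltnS /= => le_n e.
pose W := adjoin B [seq S * p.2 | p <- l].
have sW : subspace W by apply: adjoin_subspace.
have combE : comb ((m, a) :: l) = m%:P%:P * j a + comb l by rewrite /comb big_cons.
have [WSa|nWSa] := boolp.EM (W (S * a)).
  have [a' [b [[qb bE] SaE lE]]] := adjoin_shift WSa.
  have [q' q'E] : exists q', a - a' = horner_alg f q'.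
    apply: (factor r0 (q := qb)); rewrite -/S mulrBr SaE -bE.
    by rewrite addrAC subrr add0r.
  have [l' sl' l'E] := lE m.
  have cE : comb ((m, a) :: l) = comb l' + evalf (m%:P * map_poly s q').
    rewrite combE l'E rmorphM /= -j_horner_alg -q'E rmorphB evalfC; ring.
  have [||u0 u0E] := IH l' (q - map_poly s r * (m%:P * map_poly s q')).
  - by rewrite sl'.
  - by rewrite rmorphB /= [evalf (_ * _)]rmorphM /= -e cE mulrDr addrK.
  by exists (u0 + m%:P * map_poly s q'); rewrite cE u0E rmorphD.
(* This functional kills k[f] and the other multiples by S, so on r(f) u = q(f) it gives m = 0. *)
have [h [h_lin hW hSa]] := sep W (S * a) sW nWSa.
have m0 : m = 0.
  have := congr1 h e; rewrite combE mulrDr (plane_formD h_lin).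
  have -> : h (evalf (map_poly s r) * comb l) = 0.
    rewrite /comb mulr_sumr big_seq (plane_form_sum h_lin) big1 // => p pl.
    rewrite mulrCA -j_horner_alg -rmorphM (plane_formM h_lin) hW ?mulr0 //.
    apply: adjoin_mem; first by exists 0; rewrite rmorph0.
    by apply/mapP; exists p.
  rewrite mulrCA -j_horner_alg -rmorphM (plane_formM h_lin) -/S hSa mulr1 addr0 => ->.
  rewrite (evalfE (leqnn _)) (plane_form_sum h_lin) big1 // => i _.
  rewrite (plane_formM h_lin) hW ?mulr0 //; apply: adjoin_base.
  by exists 'X^i; rewrite rmorphXn /= horner_algX.
have [//|u0 u0E] := IH l q le_n.
  by rewrite -e combE m0 mul0r add0r.
by exists u0; rewrite combE m0 mul0r add0r.
Qed.

(** With denominators cleared, the two factors become polynomials in x whose product has x-degree 0.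
    Hence each factor lies in M[f], and the factorization is one of X - lam in M[X]. *)
Lemma fiber_irreducible lam : plane_irreducible (j f - lam%:P%:P).
Proof.
move=> u v uvE.
have [r r0 [P PE]] := cover_plane u; have [r' r'0 [P' P'E]] := cover_plane v.
have fE : j f - lam%:P%:P = evalf ('X - lam%:P) by rewrite rmorphB /= evalfX evalfC.
have PP' : P * P' = (map_poly s (r * r') * ('X - lam%:P))%:P.
  apply/eqP; rewrite -subr_eq0; apply/eqP/evalfx_inj.
  rewrite rmorphB rmorphM /= evalfxC -PE -P'E !rmorphM /= -fE uvE; ring.
have [|P0 [P'0 [PC P'C _]]] := polyC_factor _ PP'.
  by rewrite mulf_neq0 ?map_poly_eq0 ?mulf_neq0 // polyXsubC_eq0.
have [u0 u0E] : exists u0, u = evalf u0.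
  by apply: (@evalf_factor r u P0) => //; rewrite PE PC evalfxC.
have [v0 v0E] : exists v0, v = evalf v0.
  by apply: (@evalf_factor r' v P'0) => //; rewrite P'E P'C evalfxC.
have uv0 : u0 * v0 = 'X - lam%:P.
  apply/eqP; rewrite -subr_eq0; apply/eqP/evalf_inj.
  by rewrite rmorphB rmorphM /= -fE uvE u0E v0E subrr.
have := polyXsubC_eq0 lam; rewrite -uv0 mulf_eq0 => /norP[u00 v00].
have := size_mul u00 v00; rewrite uv0 size_XsubC => sz.
have : (size u0 = 1 \/ size v0 = 1)%N.
  have arith (a b : nat) : (0 < a -> 0 < b -> 2 = (a + b).-1 -> a = 1 \/ b = 1)%N.
    by lia.
  by apply: arith sz; rewrite size_poly_gt0.
case=> /eqP/size_poly1P[c c0 cE]; [left|right]; exists c => //.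
  by rewrite u0E cE evalfC.
by rewrite v0E cE evalfC.
Qed.

Lemma fiber_nonconst lam c : j f - lam%:P%:P != c%:P%:P.
Proof.
rewrite subr_eq -!polyCD; apply: (base_change_nonconst jP) => d fd.
have : eval2 x f ('X - d%:P)%:P = 0.
  rewrite /eval2 map_polyC hornerC /= rmorphB /= horner_algX horner_algC fd.
  by rewrite subrr.
by move/indep/eqP; rewrite polyC_eq0 polyXsubC_eq0.
Qed.
Lemma evalf_mod lam q : exists w,
  evalf q = q.[lam]%:P%:P + (j f - lam%:P%:P) * w.
Proof.
have : root (q - q.[lam]%:P) lam by rewrite rootE hornerD hornerN hornerC subrr.
case/factor_theorem=> q1 /eqP; rewrite subr_eq => /eqP qE.
exists (evalf q1); rewrite {1}qE rmorphD rmorphM rmorphB /= evalfX !evalfC; ring.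
Qed.

Lemma evalfx_mod lam Q : exists w, evalfx Q =
  (map_poly (polyC \o polyC) (map_poly (horner_eval lam) Q)).[j x]
  + (j f - lam%:P%:P) * w.
Proof.
elim/poly_ind: Q => [|Q q [w wE]].
  by exists 0; rewrite !rmorph0 horner0 mulr0 addr0.
have [w' w'E] := evalf_mod lam q.
exists (w * j x + w'); rewrite !rmorphD !rmorphM /= evalfxX evalfxC.
rewrite !map_polyX !map_polyC /= hornerD hornerMX hornerC wE w'E /horner_eval; ring.
Qed.

Lemma fiber_split p P a lam al (rs : seq M) : root (map_poly s p) lam ->
  eval2 x f P = horner_alg f p * a -> al != 0 ->
  map_poly (horner_eval lam \o map_poly s) P = al *: \prod_(z <- rs) ('X - z%:P) ->
  exists mu w, j x - mu%:P%:P = (j f - lam%:P%:P) * w.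
Proof.
set h := j f - _ => plam PE al0 Psplit.
have h0 : h != 0 by have := fiber_nonconst lam 0; rewrite !polyC0.
have [w1 w1E] := evalfx_mod lam (map_poly (map_poly s) P).
have [w2 w2E] := evalf_mod lam (map_poly s p).
have : al%:P%:P * \prod_(z <- rs) (j x - z%:P%:P) = h * (w2 * j a - w1).
  have eP : (map_poly (polyC \o polyC) (map_poly (horner_eval lam)
      (map_poly (map_poly s) P))).[j x] = al%:P%:P * \prod_(z <- rs) (j x - z%:P%:P).
    rewrite -[map_poly (horner_eval lam) _]map_poly_comp Psplit -mul_polyC rmorphM /=.
    rewrite map_polyC hornerM hornerC; congr (_ * _).
    rewrite rmorph_prod horner_prod; apply: eq_bigr => z _.
    by rewrite rmorphB /= map_polyX map_polyC hornerD hornerN hornerX hornerC.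
  rewrite -eP mulrBr mulrA; apply/eqP; rewrite eq_sym subr_eq -/h -w1E -j_eval2.
  by rewrite PE rmorphM j_horner_alg w2E (rootP plam) !polyC0 add0r.
elim: rs {Psplit} (_ - w1) => [|z rs IH] w.
  (* With no root left, f - lam divides the nonzero constant [al], hence is itself constant. *)
  rewrite big_nil mulr1 => /esym/(plane_constant_factor al0)[c hc].
  by have := fiber_nonconst lam c; rewrite -/h hc eqxx.
rewrite big_cons mulrCA.
case/(plane_irreducible_prime h0 (@fiber_irreducible lam)) => [[w' w'E]|[w' w'E]].
  by exists z, w'.
exact: (IH w').
Qed.

(* With q = p / (X - lam), q(f) (x - mu) is a multiple of p(f). If x were not in
   k[f] + p A, some functional would kill it but for the top term of q(f) x. *)
Lemma fiber_descend p lam mu w : irreducible_poly p -> root (map_poly s p) lam ->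
  j x - mu%:P%:P = (j f - lam%:P%:P) * w ->
  exists b x', x = horner_alg f b + horner_alg f p * x'.
Proof.
move=> irr_p /factor_theorem[q qE] xE; apply: boolp.contrapT => none.
have p0 := irredp_neq0 irr_p.
have q0 : q != 0.
  by apply/eqP => q0; move: p0; rewrite -(map_poly_eq0 s) qE q0 mul0r eqxx.
have sp : size p = (size q).+1.
  by rewrite -(size_map_poly s) qE size_Mmonic ?monicXsubC // size_XsubC addn2.
pose n := (size q).-1; pose S := horner_alg f.
have nE : size q = n.+1 by rewrite prednK // size_poly_gt0.
(* Here n = deg q = deg p - 1, and the bound on [t] means deg t < n: only the top term of q(f) x may
   escape [W]. *)
pose W a := exists (r t : {poly k}) (a' : A),
  (size t <= n)%N /\ a = S r + S t * x + S p * a'.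
have sW : subspace W.
  split; first by exists 0, 0, 0; rewrite size_poly0 /S rmorph0 mul0r mulr0 !addr0.
  move=> c _ _ [r1 [t1 [a1 [st1 ->]]]] [r2 [t2 [a2 [st2 ->]]]].
  exists (c *: r1 + r2), (c *: t1 + t2), (c *: a1 + a2); split.
    rewrite (leq_trans (size_polyD _ _)) // geq_max st2 andbT.
    by rewrite (leq_trans (size_scale_leq _ _)).
  rewrite /S !rmorphD /= !linearZ /= -[c *: (_ + _ + _)]mulr_algl -[c *: a1]mulr_algl.
  ring.
(* Otherwise t1 = X^n - t, of degree n < deg p, satisfies t1(f) x in k[f] + p A; inverting t1 modulo
   p by Bezout puts x itself there. *)
have nW : ~ W (S 'X^n * x).
  case=> r [t [a [st e]]]; pose t1 := 'X^n - t.
  have st1 : size t1 = n.+1.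
    by rewrite size_polyDl ?size_polyN size_polyXn.
  have cop : coprimep p t1.
    rewrite irreducible_poly_coprime //; apply/negP => /dvdp_leq.
    by rewrite -size_poly_eq0 st1 sp nE => /(_ isT); rewrite ltnn.
  have [[u1 u2] /= /eqp_size] := Bezout_coprimepP _ _ cop.
  rewrite size_poly1 => /eqP/size_poly1P[c c0 cE].
  have t1x : S t1 * x = S r + S p * a.
    by rewrite /t1 /S rmorphB /= mulrBl -/S e; ring.
  have cx : c *: x = S (u2 * r) + S p * (S u2 * a + S u1 * x).
    have -> : c *: x = S c%:P * x by rewrite /S horner_algC mulr_algl.
    rewrite -cE /S rmorphD !rmorphM /= -/S mulrDl -[S u2 * _ * x]mulrA t1x; ring.
  apply: none; exists (c^-1 *: (u2 * r)), (c^-1 *: (S u2 * a + S u1 * x)).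
  rewrite -[x in LHS]scale1r -(mulVf c0) -scalerA cx scalerDr.
  by rewrite scalerAr /S linearZ /= mulr_algl.
case: jP => _ jS sep; have [l [l_lin lW lv]] := sep W _ sW nW.
have lp u : l (evalf (map_poly s p) * u) = 0.
  have [v ->] := jS u; rewrite mulr_sumr (plane_form_sum l_lin) big1 // => i _.
  rewrite mulrCA -j_horner_alg -rmorphM (plane_formM l_lin) lW ?mulr0 //.
  by exists 0, 0, i.2; rewrite size_poly0 /S rmorph0 mul0r !add0r.
(* On the left every term but the top one is killed, so the value is the leading coefficient of q,
   which is nonzero. *)
have : l (evalf q * (j x - mu%:P%:P)) = 0.
  by rewrite xE mulrA [evalf q * _](_ : _ = evalf (map_poly s p)) ?lp //
    qE rmorphM rmorphB /= evalfX evalfC.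
rewrite mulrBr (plane_formD l_lin) -mulrN.
have -> : l (evalf q * - mu%:P%:P) = 0.
  rewrite -!polyCN mulrC (plane_formM l_lin) (evalfE (leqnn _)) (plane_form_sum l_lin).
  rewrite big1 ?mulr0 // => i _; rewrite (plane_formM l_lin) lW ?mulr0 //.
  exists 'X^i, 0, 0; rewrite size_poly0 /S rmorph0 mul0r mulr0 !addr0.
  by rewrite rmorphXn /= horner_algX.
rewrite addr0 (@evalfE n.+1) ?nE // mulr_suml (plane_form_sum l_lin) big_ord_recr /=.
rewrite big1 => [|i _]; last first.
  rewrite -mulrA -rmorphM (plane_formM l_lin) lW ?mulr0 //.
  exists 0, 'X^i, 0; rewrite size_polyXn; split; first exact: ltn_ord.
  by rewrite /S rmorph0 add0r mulr0 addr0 rmorphXn /= horner_algX.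
rewrite add0r -mulrA -rmorphM (plane_formM l_lin).
have -> : f ^+ n = S 'X^n by rewrite /S rmorphXn /= horner_algX.
rewrite lv mulr1 => /eqP; rewrite -[n]/((size q).-1) -lead_coefE lead_coef_eq0.
by rewrite (negPf q0).
Qed.
End Key.

(** * The coordinates f and x *)

Lemma descend_of_dependence (k L : fieldType) (iota : {rmorphism k -> L})
    (A : comAlgType k) (j : {rmorphism A -> {poly {poly L}}}) (f x : A)
    (p : {poly k}) (P : {poly {poly k}}) (a : A) :
  base_change_plane iota j ->
  (forall P, eval2 x f P = 0 -> P = 0) ->
  (forall a, exists2 r, r != 0 & exists P, horner_alg f r * a = eval2 x f P) ->
  (forall r a q, r != 0 -> horner_alg f r * a = horner_alg f q ->
    exists q', a = horner_alg f q') ->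
  irreducible_poly p -> ~ (forall i, p %| P`_i) ->
  eval2 x f P = horner_alg f p * a ->
  exists b x', x = horner_alg f b + horner_alg f p * x'.
Proof.
move=> jP indep cover factor irr_p ndvd PE.
have [|E1 [g1 [lam plam]]] := @exists_root L (map_poly iota p).
  by rewrite size_map_poly; case: irr_p.
have plam1 : root (map_poly (g1 \o iota) p) lam by rewrite map_poly_comp.
pose P1 := map_poly (horner_eval lam \o map_poly (g1 \o iota)) P.
(* A polynomial over k vanishing at the root lam of the irreducible p is a multiple of p, and p
   misses some coefficient of P. *)
have P10 : P1 != 0.
  apply/eqP => P10; apply: ndvd => i.
  apply: (irredp_ker (f := g1 \o iota) irr_p plam1).
  have := congr1 (fun q : {poly E1} => q`_i) P10.
  by rewrite /P1 coef0 coef_map /= => /rootP.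
have [E2 [g2 [rs rsE]]] := exists_splitting P10.
have jP2 := base_change_plane_ext g2 (base_change_plane_ext g1 jP).
have plam2 : root (map_poly (g2 \o (g1 \o iota)) p) (g2 lam).
  by rewrite map_poly_comp fmorph_root.
have [||mu [w xE]] := fiber_split (al := g2 (lead_coef P1)) (rs := rs)
  jP2 indep cover factor plam2 PE.
- by rewrite fmorph_eq0 lead_coef_eq0.
- rewrite -rsE /P1 -map_poly_comp; apply: eq_map_poly => q /=.
  by rewrite /horner_eval map_poly_comp horner_map.
exact: (fiber_descend jP2 irr_p plam2 xE).
Qed.

Lemma bijective_of_inj_surj (T1 T2 : Type) (g : T1 -> T2) : injective g ->
  (forall y, exists x, y = g x) -> bijective g.
Proof.
move=> g_inj g_surj; exists (fun y => sval (boolp.cid (g_surj y))) => [x|y].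
  by apply: g_inj; case: boolp.cid.
by case: boolp.cid.
Qed.

Section Structure.
Variables (k L : fieldType) (iota : {rmorphism k -> L}) (A : comAlgType k).
Variables (phi : {rmorphism A -> {poly A}}) (eps : {lrmorphism A -> k^o}).
Variable j : {rmorphism A -> {poly {poly L}}}.
Hypothesis ufdA : is_ufd A.
Hypothesis phi0 : forall a, (phi a).[0] = a.
Hypothesis phiD : forall a, map_poly phi (phi a) = poly_XaY (phi a).
Hypothesis phik : forall c : k, fixed phi c%:A.
Hypothesis nontriv : ~ (forall a, phi a = a%:P).
Hypothesis jP : base_change_plane iota j.

Let domA : GRing.integral_domain_axiom A. Proof. by case: ufdA. Qed.

Lemma fixed_horner_alg f p : fixed phi f -> fixed phi (horner_alg f p).
Proof.
move=> if_; elim/poly_ind: p => [|p c IH]; first by rewrite rmorph0; apply: fixed0.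
rewrite rmorphD rmorphM /= horner_algX horner_algC.
by apply: fixedD => //; apply: fixedM.
Qed.

(** The retraction gives p(0) = 0, and then a factor f cancels. *)
Lemma horner_alg_inj f p : f != 0 -> eps f = 0 -> horner_alg f p = 0 -> p = 0.
Proof.
move=> f0 epsf; elim/poly_ind: p => [//|p c IH] e.
have c0 : c = 0.
  have := eps_horner_alg eps f (p * 'X + c%:P).
  by rewrite e rmorph0 epsf hornerD hornerMX mulr0 hornerC add0r.
move: e; rewrite c0 addr0 rmorphM /= horner_algX => /domA/orP[/eqP/IH->|/eqP f00].
  by rewrite mul0r.
by rewrite f00 eqxx in f0.
Qed.

Lemma plane_coordinates : exists f x : A,
  (forall P, eval2 x f P = 0 -> P = 0) /\ (forall a, exists P, a = eval2 x f P).
Proof.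
have [f [irr_f if_ epsf]] := exists_fixed_irreducible eps ufdA phi0 phiD phik nontriv jP.
have gen := fixed_generated ufdA phi0 phik nontriv jP irr_f if_ epsf.
have f0 : f != 0 by case: irr_f.
have f_inj := horner_alg_inj f0 epsf.
have fix_f p := fixed_horner_alg p if_.
have factor r a q : r != 0 -> horner_alg f r * a = horner_alg f q ->
    exists q', a = horner_alg f q'.
  move=> r0 e; apply: gen; apply: (fixed_factor_l domA phi0 _ (fix_f r)).
    by apply: contraNneq r0 => /f_inj ->.
  by rewrite e; apply: fix_f.
have [n [x0 slx0]] := slice_ex phi0 nontriv.
have indep x : slice phi n x -> forall P, eval2 x f P = 0 -> P = 0.
  move=> slx P e; have P0 : map_poly (horner_alg f) P = 0.
    by apply: (slice_transcendental domA slx) e => i; rewrite coef_map; apply: fix_f.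
  apply/polyP => i; rewrite coef0; apply: f_inj.
  by have := congr1 (fun q : {poly A} => q`_i) P0; rewrite coef_map coef0.
have cover x : slice phi n x -> forall a, exists2 r, r != 0 &
    exists P, horner_alg f r * a = eval2 x f P.
  move=> slx a; have [N [Q Qi QE]] := slice_cover domA phi0 phiD slx a.
  have [r rE] := gen _ (slice_lead_inv phiD slx).
  exists (r ^+ N).
    rewrite expf_neq0 //; apply: contraNneq (slice_lead_neq0 slx) => r0.
    by rewrite rE r0 rmorph0.
  rewrite rmorphXn /= -rE QE.
  exists (\poly_(i < size Q) sval (boolp.cid (gen _ (Qi i)))).
  rewrite /eval2; congr _.[_]; apply/polyP => i; rewrite coef_map coef_poly.
  case: ltnP => [_|le]; first by case: boolp.cid.
  by rewrite nth_default //= rmorph0.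
(* Descent on the degree of r, where r(f) is the leading coefficient of [phi x]. If x = b(f) + p(f)
   x', then x' is again a slice of degree n, and its polynomial r' satisfies r = p r'. *)
have [x slx xmin] : exists2 x, slice phi n x &
    forall p b x', irreducible_poly p -> x <> horner_alg f b + horner_alg f p * x'.
  have [r0 r0E] := gen _ (slice_lead_inv phiD slx0).
  have [m] := ubnP (size r0); elim: m r0 x0 slx0 r0E => // m IH r x slx rE.
  rewrite ltnS => le_m; apply: boolp.contrapT => none; apply: (none); exists x => //.
  move=> p b x' irr_p xE.
  have p0 := irredp_neq0 irr_p.
  have fp0 : horner_alg f p != 0 by apply: contraNneq p0 => /f_inj ->.
  have fpP0 : (horner_alg f p)%:P != 0 by rewrite polyC_eq0.
  have phix : (horner_alg f p)%:P * phi x' = phi x - (horner_alg f b)%:P.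
    by rewrite {1}xE rmorphD rmorphM /= !fix_f addrC addKr.
  have [n0 sx minn] := slx.
  have sc : (size (- (horner_alg f b)%:P : {poly A}) < size (phi x))%N.
    by rewrite size_polyN sx ltnS (leq_trans (size_polyC_leq1 _)).
  have x'0 : phi x' != 0.
    apply/eqP => e; have := size_polyDl sc; rewrite -phix e mulr0 size_poly0 sx.
    by [].
  have sx' : size (phi x') = n.+1.
    have := dom_size_mul domA fpP0 x'0; rewrite phix size_polyDl // sx size_polyC fp0.
    by rewrite add1n.
  have slx' : slice phi n x' by [].
  have [r' r'E] := gen _ (slice_lead_inv phiD slx').
  have rr' : r = p * r'.
    apply/eqP; rewrite -subr_eq0; apply/eqP/f_inj.
    rewrite rmorphB rmorphM /= -rE -r'E -(lead_coefC (horner_alg f p)).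
    by rewrite -dom_lead_coefM // phix lead_coefDl // subrr.
  have r'0 : r' != 0.
    apply: contraNneq (slice_lead_neq0 slx') => r'0.
    by rewrite r'E r'0 rmorph0.
  have lt : (size r' < m)%N.
    apply: leq_trans le_m; rewrite rr' size_mul //.
    case: irr_p => gt1 _; move: gt1.
    by case: (size p) => [|[|d]] //= _; rewrite ltnS leq_addl.
  by case: none; apply: IH slx' r'E lt.
exists f, x; split; first exact: indep.
move=> a; have [r r0 [P PE]] := cover x slx a.
(* The denominator r is removed one irreducible factor p at a time: p divides every coefficient of
   P, since otherwise x would lie in k[f] + p A, against [xmin]. *)
have [m] := ubnP (size r); elim: m r r0 P PE => // m IH r r0 P PE.
rewrite ltnS => le_m; have [le1|gt1] := leqP (size r) 1.
  have [c rE] : exists c, r = c%:P by exists r`_0; apply: size1_polyC.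
  have c0 : c != 0 by move: r0; rewrite rE polyC_eq0.
  exists (c^-1%:P%:P * P).
  rewrite rmorphM /= -PE rE horner_algC /eval2 map_polyC /= hornerC horner_algC.
  by rewrite !mulr_algl scalerA mulVf // scale1r.
have [p irr_p /dvdpP[r' rE]] := exists_irredp gt1.
have p0 := irredp_neq0 irr_p.
have r'0 : r' != 0 by apply: contraNneq r0 => r'0; rewrite rE r'0 mul0r.
have PE' : eval2 x f P = horner_alg f p * (horner_alg f r' * a).
  by rewrite -PE rE rmorphM /= mulrAC mulrC mulrCA.
have [dvdP|ndvd] := boolp.EM (forall i, p %| P`_i); last first.
  have [b [x' /xmin[]]] :=
    descend_of_dependence jP (indep x slx) (cover x slx) factor irr_p ndvd PE'.
  exact: irr_p.
have [P' P'E] := polyC_dvd dvdP.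
apply: (IH r' r'0 P').
  apply: (domI domA (x := horner_alg f p)).
    by apply: contraNneq p0 => /f_inj ->.
  by rewrite -PE' P'E rmorphM /= {1}/eval2 map_polyC /= hornerC.
apply: leq_trans le_m; rewrite rE size_mul //.
case: irr_p => p1 _; move: p1.
by case: (size p) => [|[|d]] //= _; rewrite !addnS ltnS leq_addr.
Qed.
End Structure.

Theorem theoremC (k L : fieldType) (iota : {rmorphism k -> L})
    (A : comAlgType k)
    (formA : is_affine_form iota 2 A)
    (ufdA : is_ufd A)
    (pointA : has_rational_point A)
    (nonrigidA : non_rigid A) :
  is_poly_ring 2 A.
Proof.
have [T [tens [tensP polyT]]] := formA.
have [j jP] := tens_plane tensP polyT.
have [eps] := pointA.
have [phi [[phi0 phiD] nontriv]] := nonrigidA.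
have phik (c : k) : fixed phi c%:A.
  have e : phi (c *: 1) = c%:A *: phi 1 by rewrite linearZ.
  by rewrite /fixed [LHS]e rmorph1 alg_polyC.
have [f [x [inj surj]]] :=
  plane_coordinates eps ufdA phi0 phiD phik nontriv jP.
pose F : {mpoly k[2]} -> A := eval2 x f \o @plane_of_mpoly k.
have F_inj : injective F.
  move=> p q e; apply: (can_inj (@plane_of_mpolyK k)); apply/subr0_eq/inj.
  have evalB u v : eval2 x f (u - v) = eval2 x f u - eval2 x f v.
    exact: rmorphB.
  rewrite evalB; move: e; rewrite /F /=.
  by move=> ->; rewrite subrr.
have F_surj a : exists p, a = F p.
  have [P ->] := surj a; exists (mpoly_of_plane P).
  by rewrite /F /= mpoly_of_planeK.
have FZ : scalable F.
  move=> c p; rewrite /F /= -mul_mpolyC rmorphM /= plane_of_mpolyC rmorphM /=.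
  by rewrite {1}/eval2 map_polyC /= hornerC horner_algC mulr_algl.
pose G : {lrmorphism {mpoly k[2]} -> A} :=
  HB.pack_for {lrmorphism {mpoly k[2]} -> A} F
    (GRing.isZmodMorphism.Build _ _ F (rmorphB F))
    (GRing.isMonoidMorphism.Build _ _ F (rmorph1 F, rmorphM F))
    (GRing.isScalable.Build _ _ _ _ F FZ).
by exists G; apply: bijective_of_inj_surj.
Qed.
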